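(* Let $\mathcal{H}^1$ be the undirected graph and $\mathcal{D}$ the flow network associated with $\mathcal{G},A,Y,L,N,c$ as described in the context, with at least one $L$-$N$ adjustment set existing, and let $\mathfrak{d}$ and $\mathfrak{h}$ be the maps defined in the context. 1. Let $Z$ be a minimal separator in $\mathcal{H}^1$. Then $\mathfrak{d}(Z)$ is a cut in $\mathcal{D}$ with $k\{\mathfrak{d}(Z)\}=c(Z)$. 2. Let $S$ be a cut in $\mathcal{D}$ with finite capacity. Then $\mathfrak{h}(S)$ is a separator in $\mathcal{H}^1$ with $c\{\mathfrak{h}(S)\}=k(S)$. 3. Let $Z$ be a minimum cost separator in $\mathcal{H}^1$. Then $\mathfrak{d}(Z)$ is a min-cut in $\mathcal{D}$. 4. Let $S$ be a min-cut in $\mathcal{D}$. Then $\mathfrak{h}(S)$ is a minimum cost separator in $\mathcal{H}^1$. 5. Let $Z$ be a minimum cost separator in $\mathcal{H}^1$. Then $\mathfrak{h}\{\mathfrak{d}(Z)\}=Z$.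
   Context: **Graphs and model.** $\mathcal{G}$ is a directed acyclic graph with finite vertex set $V$, identified with a random vector. Every vertex is its own ancestor and descendant; $\mathrm{pa}_{\mathcal{G}},\mathrm{an}_{\mathcal{G}},\mathrm{de}_{\mathcal{G}}$ denote parents, ancestors, descendants, and $\mathrm{nd}_{\mathcal{G}}(W)=V\setminus \mathrm{de}_{\mathcal{G}}(W)$; for a set $Z$ of vertices, $\mathrm{an}_{\mathcal{G}}(Z)$ and $\mathrm{de}_{\mathcal{G}}(Z)$ are the unions over $W\in Z$. A path is a sequence of successively adjacent vertices (vertices may be repeated). The Bayesian network $\mathcal{M}(\mathcal{G})$ is the collection of laws $P$ of $V$ (assumed to have a density with respect to a dominating measure) such that each $W\in V$ is independent of $\mathrm{nd}_{\mathcal{G}}(W)$ given $\mathrm{pa}_{\mathcal{G}}(W)$ under $P$. Distinguished vertices are $A$ (treatment, taking values in a finite set) and $Y$ (real-valued outcome). $N\subset V$ is the set of observable variables and $L$ a set of vertices. Standing assumptions: $Y\in \mathrm{de}_{\mathcal{G}}(A)$, $\{A,Y\}\cup L\subset N$, $L\subset \mathrm{nd}_{\mathcal{G}}(A)$. Each $W\in N$ has a cost $c(W)>0$, and $c(Z)=\sum_{W\in Z}c(W)$. **Adjustment sets.** $Z\subset V\setminus\{A,Y\}$ is an $L$-$N$ adjustment set if $L\subset Z\subset N$ and for all conditional laws $\pi(A\mid L)$ of $A$ given $L$, all $P\in\mathcal{M}(\mathcal{G})$ and all $y\in\mathbb{R}$, $$E_P\left(E_{\pi^{\ast}}\left[E_P\{I_{(-\infty,y]}(Y)\mid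 A,\mathrm{pa}_{\mathcal{G}}(A),L\}\mid \mathrm{pa}_{\mathcal{G}}(A),L\right]\right)=E_P\left(E_{\pi^{\ast}_Z}\left[E_P\{I_{(-\infty,y]}(Y)\mid A,Z\}\mid Z\right]\right),$$ where $E_{\pi^\ast}$ (resp. $E_{\pi^\ast_Z}$) integrates over $A$ under $\pi^{\ast}\{A\mid \mathrm{pa}_{\mathcal{G}}(A),L\}\equiv\pi(A\mid L)$ (resp. $\pi_Z^{\ast}(A\mid Z)\equiv \pi(A\mid L)$). It is assumed throughout that at least one $L$-$N$ adjustment set exists. **The undirected graph $\mathcal{H}^1$.** Let $\mathrm{cn}(A,Y,\mathcal{G})$ be the set of vertices other than $A$ lying on a directed path from $A$ to $Y$, and $\mathrm{forb}(A,Y,\mathcal{G})=\mathrm{de}_{\mathcal{G}}(\mathrm{cn}(A,Y,\mathcal{G}))\cup\{A\}$. Let $\mathcal{G}^{pbd}(A,Y)$ be $\mathcal{G}$ with the first edge of every directed path from $A$ to $Y$ removed. The moral graph of a DAG is the undirected graph on the same vertices with an edge $U-W$ whenever $U\to W$, $W\to U$, or $U\to C\leftarrow W$ for some vertex $C$. Let $\mathcal{H}^0$ be the moral graph of the subgraph of $\mathcal{G}^{pbd}(A,Y)$ induced by $\mathrm{an}_{\mathcal{G}}(\{A,Y\}\cup L)$. Let $\mathrm{ignore}=\{\mathrm{an}_{\mathcal{G}}(\{A,Y\}\cup L)\setminus\{A,Y\}\}\cap\{(V\setminus N)\cup\mathrm{forb}(A,Y,\mathcal{G})\}$. $\mathcal{H}^1$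 is obtained from $\mathcal{H}^0$ by (1) removing all vertices in $\mathrm{ignore}$, (2) adding an edge between any pair of remaining vertices that were connected in $\mathcal{H}^0$ by a path with (intermediate) vertices in $\mathrm{ignore}$, and (3) adding an edge between $A$ and each vertex in $L$ and between $Y$ and each vertex in $L$. **Separators.** A separator in $\mathcal{H}^1$ is a set $Z$ of vertices of $\mathcal{H}^1$, disjoint from $\{A,Y\}$, such that every path in $\mathcal{H}^1$ between $A$ and $Y$ intersects $Z$. It is minimal if no proper subset is a separator, and minimum cost if $c(Z)\le c(Z')$ for every separator $Z'$. **The flow network $\mathcal{D}$.** For each vertex $W$ of $\mathcal{H}^1$, $\mathcal{D}$ has two vertices $W',W''$ and an internal edge $W'\to W''$. For each edge $U-W$ of $\mathcal{H}^1$, $\mathcal{D}$ has external edges $U''\to W'$ and $W''\to U'$. The capacity $k(W'\to W'')$ equals $c(W)$ if $W\notin\{A,Y\}$ and $+\infty$ if $W\in\{A,Y\}$; external edges have capacity $+\infty$. The source is $Y''$ and the sink is $A'$. For a set $S$ of vertices, $\overline{S}$ is its complement and $(S,\overline{S})$ is the set of edges from $S$ to $\overline{S}$. A cut is a vertex set containing the source but not the sink; its capacity is $k(S)=\sum_{e\in(S,\overline{S})}k(e)$. A min-cut is a cut of minimal capacity. **The maps.** For a minimal separator $Z$ in $\mathcal{H}^1$, $\mathfrak{d}(Z)$ is the set formed by $Y''$ and all vertices of $\mathcal{D}$ that lie on some directed path $\delta$ from $Y''$ to a vertex $W'$ for some $W\in Z$, where $\delta$ does not intersect any other $U'$ or $U''$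 for $U\in Z$ (that is, the final vertex $W'$ is the only vertex of $\delta$ of the form $U'$ or $U''$ with $U\in Z$). For a cut $S$ in $\mathcal{D}$ with finite capacity, $\mathfrak{h}(S)=\{W:(W',W'')\in(S,\overline{S})\}$.
   Formalization: Items 1 and 3 are stated for nonempty Z, since d(∅)={Y''} has infinite capacity if Y has a neighbour in H^1 while c(∅)=0, and A is assumed to have at least two possible values, since for a one-valued A item 4 fails when A and Y are adjacent in H^1. *)

(* Defs.v *)
From HB Require Import structures.
From mathcomp Require Import all_boot all_order all_algebra.
From mathcomp Require Import finmap.
From mathcomp Require Import all_classical all_reals all_analysis measurable_realfun.

Set Implicit Arguments.
Unset Strict Implicit.
Unset Printing Implicit Defensive.

Import Order.TTheory GRing.Theory Num.Theory.
Import numFieldNormedType.Exports.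

Local Open Scope ring_scope.

(** * Directed graphs

    A directed graph on the finite type [V] is a relation [e : rel V], where
    [e u w] stands for the edge [u -> w].  A directed path from [u] to [w] is
    given by the sequence [p] of the vertices that follow [u] (so the sequence
    of its vertices is [u :: p]); vertices may be repeated. *)

Section DirectedGraph.
Variable (V : finType).
Implicit Types (e : rel V) (u w : V) (X : {set V}).

Definition dipath (T : eqType) (e : rel T) (u : T) (p : seq T) (w : T) : bool :=
  path e u p && (last u p == w).

Definition acyclic e : Prop := forall u p, p != [::] -> ~~ dipath e u p u.

Definition pa e w : {set V} := [set u | e u w].

(* [connect e] is the reflexive transitive closure of [e], so every vertex is
   its own ancestor and its own descendant. *)
Definition an e X : {set V} := [set u | [exists w in X, connect e u w]].
Definition de e X : {set V} := [set u | [exists w in X, connect e w u]].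
Definition nd e X : {set V} := ~: de e X.

Definition cn e (A Y : V) : {set V} :=
  [set w | (w != A) && `[< exists2 p, dipath e A p Y & w \in A :: p >]].

Definition forb e (A Y : V) : {set V} := de e (cn e A Y) :|: [set A].

Definition pbd e (A Y : V) : rel V :=
  fun u w => e u w && ~~ ((u == A) && `[< exists p, dipath e A (w :: p) Y >]).

Definition induced (X : {set V}) e : rel V :=
  fun u w => [&& u \in X, w \in X & e u w].

Definition moral e : rel V :=
  fun u w => (u != w) && [|| e u w, e w u | [exists x, e u x && e w x]].

End DirectedGraph.

(** * The undirected graphs H0 and H1 *)

Section UndirectedGraph.
Variables (V : finType) (e : rel V) (A Y : V) (L N : {set V}).

Definition anAYL : {set V} := an e ([set A; Y] :|: L).

Definition H0 : rel V := moral (induced anAYL (pbd e A Y)).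

Definition ignore : {set V} :=
  (anAYL :\: [set A; Y]) :&: (~: N :|: forb e A Y).

Definition H1_vertices : {set V} := anAYL :\: ignore.

(* The case [p = [::]] below covers the edges of H0 between remaining
   vertices. *)
Definition H1 : rel V := fun u w =>
  [&& u \in H1_vertices, w \in H1_vertices, u != w &
   [|| `[< exists2 p, path H0 u (rcons p w) & {subset p <= ignore} >],
       (u \in [set A; Y]) && (w \in L) |
       (w \in [set A; Y]) && (u \in L)]].

Definition separator (Z : {set V}) : Prop :=
  [/\ Z \subset H1_vertices, [disjoint Z & [set A; Y]] &
      forall p, dipath H1 A p Y -> exists2 w, w \in A :: p & w \in Z].

Definition minimal_separator (Z : {set V}) : Prop :=
  separator Z /\ forall Z' : {set V}, Z' \proper Z -> ~ separator Z'.

End UndirectedGraph.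

(** * Costs *)

Definition cost (R : realType) (V : finType) (c : V -> R) (Z : {set V}) : R :=
  \sum_(w in Z) c w.

Definition min_cost_separator (R : realType) (V : finType) (e : rel V)
    (A Y : V) (L N : {set V}) (c : V -> R) (Z : {set V}) : Prop :=
  separator e A Y L N Z /\
  forall Z' : {set V}, separator e A Y L N Z' -> cost c Z <= cost c Z'.

(** * The flow network D

    The vertices [W'] and [W''] are encoded by [(W, false)] and [(W, true)]. *)

Section FlowNetwork.
Variables (R : realType) (V : finType) (e : rel V) (A Y : V) (L N : {set V}).
Variable (c : V -> R).

Definition inn (w : V) : V * bool := (w, false).
Definition out (w : V) : V * bool := (w, true).

Definition D_vertices : {set V * bool} := [set x | x.1 \in H1_vertices e A Y L N].

Definition D_internal (x y : V * bool) : bool :=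
  [exists w in H1_vertices e A Y L N, (x == inn w) && (y == out w)].

Definition D_external (x y : V * bool) : bool :=
  [exists u, exists w, [&& H1 e A Y L N u w, x == out u & y == inn w]].

Definition D : rel (V * bool) := fun x y => D_internal x y || D_external x y.

Definition source : V * bool := out Y.
Definition sink : V * bool := inn A.

(* Only meaningful when [f] is an edge of D; an internal edge is one of the form
   (W', W''). *)
Definition capacity (f : (V * bool) * (V * bool)) : \bar R :=
  if D_internal f.1 f.2 && (f.1.1 \notin [set A; Y]) then (c f.1.1)%:E else +oo%E.

Definition cut_edges (S : {set V * bool}) : {set (V * bool) * (V * bool)} :=
  [set f | [&& f.1 \in S, f.2 \in D_vertices :\: S & D f.1 f.2]].

Definition is_cut (S : {set V * bool}) : Prop :=
  [/\ S \subset D_vertices, source \in S & sink \notin S].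

Definition cut_capacity (S : {set V * bool}) : \bar R :=
  (\sum_(f in cut_edges S) capacity f)%E.

Definition min_cut (S : {set V * bool}) : Prop :=
  is_cut S /\ forall S', is_cut S' -> (cut_capacity S <= cut_capacity S')%E.

Definition dmap (Z : {set V}) : {set V * bool} :=
  source |: [set x | `[< exists w p,
     [/\ w \in Z, dipath D source p (inn w),
         forall y, y \in source :: p -> y.1 \in Z -> y = inn w &
         x \in source :: p] >]].

Definition hmap (S : {set V * bool}) : {set V} :=
  [set w | (inn w, out w) \in cut_edges S].

End FlowNetwork.

(** * Laws of the random vector

    The random vector has one real coordinate per vertex, so its laws are the
    probability measures on [V -> R] with the product sigma-algebra. *)

Local Open Scope classical_set_scope.

Section Laws.
Variables (R : realType) (V : finType).

Definition cylinders (X : {set V}) : set (set (V -> R)) :=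
  [set B | exists2 w, w \in X &
     exists2 C : set R, measurable C & B = (fun v => v w) @^-1` C].

(* [coordT X] is [V -> R] with the sigma-algebra generated by the coordinates
   in [X]; a real function measurable on [coordT X] only depends on these
   coordinates. *)
Definition coordT (X : {set V}) := g_sigma_algebraType (cylinders X).

Definition sample := coordT [set: V]%SET.

Implicit Types (P : probability sample R) (X U D : {set V}) (v : V -> R).

(* [g] is a version of E_P(f | X). *)
Definition cond_exp P X (f g : (V -> R) -> R) : Prop :=
  [/\ measurable_fun [set: coordT X] (g : coordT X -> R),
      P.-integrable setT (EFin \o g) &
      forall B : set (V -> R), <<s cylinders X >> B ->
        (\int[P]_(v in B) (g v)%:E = \int[P]_(v in B) (f v)%:E)%E].

Definition cond_prob P X (B : set (V -> R)) (g : (V -> R) -> R) : Prop :=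
  cond_exp P X \1_B g.

(* Versions of conditional probabilities exist and are almost surely unique, so
   that it does not matter which ones are chosen. *)
Definition cond_indep P X U D : Prop :=
  forall B C : set (V -> R), <<s cylinders X >> B -> <<s cylinders U >> C ->
  exists gB gC gBC,
    [/\ cond_prob P D B gB, cond_prob P D C gC, cond_prob P D (B `&` C) gBC &
        {ae P, forall v, gBC v = gB v * gC v}].

Definition has_density P : Prop :=
  exists (mu : {sigma_finite_measure set sample -> \bar R})
         (p : sample -> \bar R),
    [/\ measurable_fun [set: sample] p, forall v, (0 <= p v)%E &
        forall B, measurable B -> P B = (\int[mu]_(v in B) p v)%E].

(* The treatment [A] takes its values in the finite set [TA]. *)
Definition bayes_net (e : rel V) (A : V) (TA : {fset R}) P : Prop :=
  [/\ has_density P, P [set v : V -> R | v A \in TA] = 1%E &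
      forall w, cond_indep P [set w]%SET (nd e [set w]%SET) (pa e w)].

(** * Adjustment sets *)

(* [q a v] is the probability of the treatment level [a] given the coordinates
   of [v] in [L]. *)
Definition cond_law (L : {set V}) (TA : {fset R})
    (q : R -> (V -> R) -> R) : Prop :=
  forall a, a \in TA ->
    [/\ measurable_fun [set: coordT L] (q a : coordT L -> R),
        forall v, 0 <= q a v & forall v, \sum_(b <- TA) q b v = 1].

Definition set_coord (w : V) (a : R) v : V -> R :=
  fun u => if u == w then a else v u.

(* The levels of treatment to which [q] gives mass have positive probability
   given [X]; this is what makes the integral over [A] of a conditional
   expectation given [A] and [X] independent of the version. *)
Definition positivity P (A : V) (TA : {fset R}) (q : R -> (V -> R) -> R) X :=
  forall a, a \in TA ->
  exists2 g, cond_prob P X [set v | v A = a] g &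
    {ae P, forall v, 0 < q a v -> 0 < g v}.

(* E_P(E_q(m | X)), where [m] is a function of [A] and [X], and [A] is
   integrated under [q]. *)
Definition adjusted_mean P (A : V) (TA : {fset R}) (q : R -> (V -> R) -> R)
    (m : (V -> R) -> R) : \bar R :=
  (\int[P]_v (\sum_(a <- TA) q a v * m (set_coord A a v))%:E)%E.

Definition adjustment_set (e : rel V) (A Y : V) (TA : {fset R})
    (L N Z : {set V}) : Prop :=
  [/\ Z \subset ~: [set A; Y]%SET, L \subset Z, Z \subset N &
   forall (q : R -> (V -> R) -> R) P (y : R) (m mZ : (V -> R) -> R),
     cond_law L TA q -> bayes_net e A TA P ->
     positivity P A TA q (pa e A :|: L)%SET -> positivity P A TA q Z ->
     cond_exp P (A |: (pa e A :|: L))%SET \1_[set v | v Y <= y] m ->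
     cond_exp P (A |: Z)%SET \1_[set v | v Y <= y] mZ ->
     adjusted_mean P A TA q m = adjusted_mean P A TA q mZ].

End Laws.

(* Main.v *)
Require Import Defs.
From HB Require Import structures.
From mathcomp Require Import all_boot all_order all_algebra.
From mathcomp Require Import finmap.
From mathcomp Require Import all_classical all_reals all_analysis measurable_realfun.
From mathcomp Require Import ring lra.
Set Implicit Arguments.
Unset Strict Implicit.
Unset Printing Implicit Defensive.
Import Order.TTheory GRing.Theory Num.Theory.
Import numFieldNormedType.Exports.
Local Open Scope ring_scope.

(** Most of the proposition is elementary.  A walk of [D] alternates between
    external and internal edges, so it is a walk of [H1] in which every visited
    vertex costs its internal edge.  A cut of finite capacity is crossed by
    internal edges only; the vertices of these edges meet every walk of [H1]
    from [Y] to [A], and their cost is the capacity of the cut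
    ([finite_cut_separator]).  Conversely, [dmap Z] consists of the vertices of
    [D] that lie on the way from the source to a first visit of [Z]; when [Z]
    is a nonempty minimal separator, every vertex of [Z] has such a first
    visit, and the edges out of [dmap Z] are exactly the internal edges of [Z]
    ([dmap_cut_edges]).  Costs are positive on [H1], so a minimum cost
    separator is minimal, and the two maps exchange minimum cost separators
    and min-cuts.

    One point is not elementary: a min-cut yields a separator only if it has
    finite capacity, that is, if a separator exists, that is, if [A] and [Y]
    are not adjacent in [H1].  This is where the existence of an adjustment
    set [Z] enters ([adjustment_set_not_adjacent]).  An edge between [A] and
    [Y] in [H1] is a walk in [H0] through vertices that are hidden or
    forbidden; no such vertex belongs to [Z], because [Z] is observable and
    contains no forbidden vertex ([adjustment_set_not_forb]), whereas every
    walk of [H0] from [A] to [Y] has to meet [Z] ([adjustment_set_blocks]).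
    Both facts are proved by exhibiting, when they fail, a law of the Bayesian
    network for which the two sides of the adjustment formula differ.

    These laws come from structural models: independent bits [b v], one per
    vertex, are fair except one, which equals 1 with probability 1/4, and each
    vertex takes a value that is a function of the values of its parents and
    of its own bit.  Every such model is Markov with respect to the graph
    ([bits_bayes_net]), and since the law has finite support all conditional
    expectations have explicit versions ([cond_mean]).

    - If [F] is a forbidden vertex in [Z], there is a child [v1] of [A] that
      is an ancestor of both [F] and [Y].  Let [A] be its own bit, let [v1] be
      a noisy copy of [A], and let all descendants of [v1] copy [v1].
      Intervening on [A] changes the law of [Y], but [F] already reveals [Y],
      so adjusting for [Z] shows no effect: the two sides are 1/4 and 1/2.

    - If a walk [A = u_0, ..., u_k = Y] of [H0] avoids [Z], consider for each
      step the difference (exclusive or) of the bits of [u_i] and [u_(i+1)].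
      A step of the moral graph has a vertex that sees both bits, and this
      vertex is an ancestor of [A], of [Y] or of some vertex of [L].  Let every
      vertex pass on to its children all differences that it knows, but reveal
      its own bit only if it is not in [Z].  Let [A] be the sum of the
      differences assigned to [A], and [Y] the sum of those assigned to [Y]
      plus the bit of [Y].  The differences telescope along the walk, whence
      [A + Y + zeta = b A], where [zeta], the sum of the remaining differences,
      is a function of the coordinates in [L].  Now choose the treatment
      [A = zeta].  Since [A] has no effect on [Y] in this model, the first side
      is the probability that [Y = 0], which is 1/2.  On the other hand, given
      [A = zeta] and [Z] the outcome [Y] equals [b A].  Changing all bits at
      once modifies neither the values on [Z] nor that of [A], so that [Z] and
      [A] carry no information on [b A] beyond its odds 3 : 1, and the second
      side is 3/4. *)

(** * Laws with finite support *)

Local Open Scope classical_set_scope.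

(** A law is used only through the integrals that it defines; describing it by
    them avoids equalities between measure structures. *)
Definition discrete_law (R : realType) (d : measure_display)
    (T : measurableType d) (Om : finType) (mu : Om -> R) (X : Om -> T)
    (P : set T -> \bar R) : Prop :=
  forall (B : set T) (f : T -> R),
  measurable B -> measurable_fun setT f -> (forall v, 0 <= f v) ->
  (\int[P]_(v in B) (f v)%:E = (\sum_b mu b * \1_B (X b) * f (X b))%:E)%E.

Lemma discrete_law_exists (R : realType) (d : measure_display)
    (T : measurableType d) (Om : finType) (mu : Om -> R) (X : Om -> T) :
  (forall b, 0 <= mu b) -> \sum_b mu b = 1 ->
  exists P : probability T R, discrete_law mu X P.
Proof.
move=> mu_ge0 mu1.
case: (pickP (@predT Om)) => [b0 _|Om0]; last first.
  by move: mu1; rewrite big_pred0 // => /eqP; rewrite eq_sym oner_eq0.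
pose w (i : nat) : Om := nth b0 (enum Om) i.
pose m_ (i : nat) := mscale (NngNum (mu_ge0 (w i))) (@dirac _ T (X (w i)) R).
pose m : {measure set T -> \bar R} := msum m_ #|Om|.
have sumE (F : Om -> \bar R) : (\sum_(n < #|Om|) F (w n) = \sum_b F b)%E.
  rewrite -(big_mkord xpredT (fun n => F (w n))) -[in RHS]big_enum/=.
  by rewrite (big_nth b0) -cardE.
have m1 : m setT = 1%E.
  rewrite -mu1 -sumEFin -(sumE (fun b => (mu b)%:E)).
  apply: eq_bigr => i _.
  transitivity ((mu (w i))%:E * dirac (X (w i)) setT)%E => //.
  by rewrite diracT mule1.
pose P : probability T R := mnormalize m (@dirac _ T (X b0) R).
have Pm : P = m :> (set T -> \bar R).
  apply/funext => U; rewrite /P/= /mnormalize m1.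
  by rewrite eqe oner_eq0 /= invr1 mule1.
exists P; rewrite Pm => B f mB mf f0.
have mf' D : measurable_fun D (EFin \o f).
  by apply/measurable_EFinP; apply: measurable_funTS.
rewrite ge0_integral_measure_sum //; last by move=> v _; rewrite lee_fin.
rewrite -sumEFin -(sumE (fun b => (mu b * \1_B (X b) * f (X b))%:E)).
apply: eq_bigr => i _.
rewrite ge0_integral_mscale//; last by move=> v _; rewrite lee_fin.
by rewrite integral_dirac // diracE indicE /= !EFinM muleA.
Qed.

Lemma discrete_law_prob (R : realType) (d : measure_display)
    (T : measurableType d) (Om : finType) (mu : Om -> R) (X : Om -> T)
    (P : probability T R) (B : set T) :
  discrete_law mu X P -> measurable B ->
  P B = (\sum_b mu b * \1_B (X b))%:E.
Proof.
move=> PX mB; have := PX B (cst 1) mB (measurable_cst _) (fun=> ler01).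
rewrite (@integral_cst _ _ _ P B mB 1) mul1e => ->; congr EFin.
by apply: eq_bigr => b _; rewrite mulr1.
Qed.

(** * Conditional expectations under a law with finite support *)

Definition agree (R : realType) (V : finType) (D : {set V}) (v v' : V -> R) :=
  [forall w in D, v w == v' w].

Lemma agreeP (R : realType) (V : finType) (D : {set V}) (v v' : V -> R) :
  reflect {in D, v =1 v'} (agree D v v').
Proof.
apply: (iffP forallP) => [vv' w wD|vv' w]; first exact/eqP/(implyP (vv' w)).
by apply/implyP => wD; rewrite vv'.
Qed.

Lemma agree_refl (R : realType) (V : finType) (D : {set V}) (v : V -> R) :
  agree D v v.
Proof. exact/agreeP. Qed.

Lemma agree_sym (R : realType) (V : finType) (D : {set V}) (v v' : V -> R) :
  agree D v v' = agree D v' v.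
Proof. by apply/agreeP/agreeP => vv' w wD; rewrite vv'. Qed.

Lemma agree_trans (R : realType) (V : finType) (D : {set V}) (u v w : V -> R) :
  agree D u v -> agree D u w = agree D v w.
Proof.
by move=> /agreeP uv; apply/agreeP/agreeP => H x xD; rewrite -H // uv.
Qed.

(** The events that do not distinguish [v] from [v'] form a sigma-algebra, and
    it contains the cylinders over [D]. *)
Lemma generated_coord_saturated (R : realType) (V : finType) (D : {set V})
    (B : set (V -> R)) (v v' : V -> R) :
  <<s cylinders D >> B -> agree D v v' -> B v -> B v'.
Proof.
move=> sB /agreeP vv'; suff [] : B v <-> B v' by [].
pose S : set (set (V -> R)) := [set C | C v <-> C v'].
apply: (sB S); split; last first.
  by move=> _ [w wD [C mC ->]]; rewrite /S /= vv'.
split=> //.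
- by move=> C [CC CC']; split=> -[_ nC]; split=> // ?; apply: nC; auto.
- move=> F FS; split=> -[i _ Fi]; exists i => //; exact/(FS i).
Qed.

Lemma generated_coord_measurable (R : realType) (V : finType) (D : {set V})
    (B : set (V -> R)) :
  <<s cylinders D >> B -> measurable (B : set (sample R V)).
Proof.
apply: sub_smallest2r; first exact: smallest_sigma_algebra.
by move=> _ [w wD [C mC ->]]; exists w; [rewrite finset.inE|exists C].
Qed.

Lemma measurable_coord (R : realType) (V : finType) (D : {set V}) (w : V)
    (C : set R) :
  w \in D -> measurable C -> measurable ([set v | C (v w)] : set (coordT R D)).
Proof. by move=> wD mC; apply: sub_gen_smallest; exists w => //; exists C. Qed.

(** All functions used below depend on [v] only through the finitely many tests
    whether a coordinate of [v] takes one of the values that it has in the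
    support; the next lemmas turn this into measurability. *)
Section FiniteSupport.
Variables (R : realType) (V Om : finType) (X : Om -> V -> R).

Lemma measurable_set_atoms (D : {set V}) (B : set (coordT R D)) :
  (forall v v' : V -> R,
    (forall w b, w \in D -> (v w == X b w) = (v' w == X b w)) -> B v -> B v') ->
  measurable B.
Proof.
move=> BD.
(* the results of all the tests *)
pose fp (v : V -> R) : {set V * Om} :=
  [set x | (x.1 \in D) && (v x.1 == X x.2 x.1)]%SET.
have -> : B = \bigcup_(s in [set s | exists2 v, B v & fp v = s])
      \bigcap_(x in [set: V * Om]) [set v | (x \in fp v) = (x \in s)].
  apply/seteqP; split=> [v Bv|v [_ [v' Bv' <-] H]].
    by exists (fp v) => //; exists v.
  apply: BD Bv' => w b wD; move: (H (w, b) I).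
  by rewrite /= !finset.inE /= wD.
apply: (@fin_bigcup_measurable _ (coordT R D : measurableType _)) => [|s _].
  exact: (@finite_finset {set V * Om}).
apply: (@fin_bigcap_measurable _ (coordT R D : measurableType _)) => [|[w b] _].
  exact: (@finite_finset (V * Om)%type).
have [wD|wD] := boolP (w \in D); last first.
  have E (v : V -> R) : ((w, b) \in fp v) = false.
    by rewrite finset.inE (negbTE wD).
  case: ((w, b) \in s).
    rewrite (_ : [set _ | _] = set0); first exact: measurable0.
    by apply/seteqP; split=> v //=; rewrite E.
  rewrite (_ : [set _ | _] = setT); first exact: measurableT.
  by apply/seteqP; split=> v //= _; rewrite E.
have -> : [set v : coordT R D | ((w, b) \in fp v) = ((w, b) \in s)] =
    [set v | (if (w, b) \in s then [set X b w] else ~` [set X b w]) (v w)].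
  apply/seteqP; split=> v /=; rewrite finset.inE /= wD /=;
    case: ifP => _ /=; [by move/eqP|by move/eqP|by move=> ->; rewrite eqxx|].
  by move/eqP/negbTE.
apply: measurable_coord => //; case: ifP => _; first exact: measurable_set1.
by apply: measurableC; apply: measurable_set1.
Qed.

Lemma measurable_fun_atoms (D : {set V}) (f : coordT R D -> R) :
  (forall v v' : V -> R,
    (forall w b, w \in D -> (v w == X b w) = (v' w == X b w)) -> f v = f v') ->
  measurable_fun setT f.
Proof.
move=> fD _ C mC; rewrite setTI; apply: measurable_set_atoms => v v' vv' /=.
by rewrite (fD v v').
Qed.

End FiniteSupport.

Section DiscreteLaw.
Variables (R : realType) (V Om : finType) (mu : Om -> R) (X : Om -> V -> R).
Variable (P : probability (sample R V) R).
Hypothesis mu_gt0 : forall b, 0 < mu b.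
Hypothesis P_law : discrete_law mu (X : Om -> sample R V) P.

Let mu_ge0 b : 0 <= mu b. Proof. exact: ltW. Qed.

(** Elementary conditional expectation; it is 0 when no point of the support
    agrees with [v] on [D]. *)
Definition cond_mean (D : {set V}) (F : Om -> R) (v : V -> R) : R :=
  (\sum_(b | agree D v (X b)) mu b * F b) / \sum_(b | agree D v (X b)) mu b.

Lemma cond_mean_ge0 D F v : (forall b, 0 <= F b) -> 0 <= cond_mean D F v.
Proof.
move=> F0; rewrite /cond_mean divr_ge0 // sumr_ge0 // => b _.
by rewrite mulr_ge0.
Qed.

Lemma agree_atoms (D : {set V}) (v v' : V -> R) b :
  (forall w b, w \in D -> (v w == X b w) = (v' w == X b w)) ->
  agree D v (X b) = agree D v' (X b).
Proof.
move=> vv'; apply/agreeP/agreeP => H w wD; apply/eqP.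
  by rewrite -vv' // H.
by rewrite vv' // H.
Qed.

Lemma cond_mean_atoms (D : {set V}) F (v v' : V -> R) :
  (forall w b, w \in D -> (v w == X b w) = (v' w == X b w)) ->
  cond_mean D F v = cond_mean D F v'.
Proof.
move=> vv'; rewrite /cond_mean; congr (_ / _);
  by apply: eq_bigl => b; apply: agree_atoms.
Qed.

Lemma sum_agree_gt0 D v b0 : agree D v (X b0) ->
  0 < \sum_(b | agree D v (X b)) mu b.
Proof. by move=> vb0; rewrite (bigD1 b0) //= ltr_pwDl // sumr_ge0. Qed.

(** The tower property, for the events [B] that are determined by the
    coordinates in [D].  It makes [cond_mean] a version of the conditional
    expectation. *)
Lemma cond_mean_total (D : {set V}) (F : Om -> R) (B : pred Om) :
  (forall b b', agree D (X b) (X b') -> B b -> B b') ->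
  \sum_(b | B b) mu b * cond_mean D F (X b) = \sum_(b | B b) mu b * F b.
Proof.
move=> BD.
have BDs b b' : agree D (X b) (X b') -> B b = B b'.
  by move=> bb'; apply/idP/idP; apply: BD; rewrite // agree_sym.
pose N b := \sum_(b' | agree D (X b) (X b')) mu b'.
have N0 b : N b != 0.
  by rewrite gt_eqF // (@sum_agree_gt0 D _ b) ?agree_refl.
have E b : mu b * cond_mean D F (X b) =
    \sum_(b' | agree D (X b) (X b')) mu b * (mu b' * F b' / N b').
  rewrite /cond_mean mulr_suml mulr_sumr; apply: eq_bigr => b' bb'.
  rewrite (_ : N b' = N b) // /N; apply: eq_bigl => b''.
  by rewrite (agree_trans _ bb').
under eq_bigr do rewrite E.
rewrite (exchange_big_dep B) /=; last by move=> b b' /[swap]; apply: BD.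
apply: eq_bigr => b' Bb'; rewrite -mulr_suml.
rewrite (_ : \sum_(_ | _) _ = N b').
  by rewrite mulrC divfK.
apply: eq_bigl => b; rewrite agree_sym andbC.
by case bb': (agree _ _ _); rewrite //= (BDs b b') // agree_sym.
Qed.

Lemma discrete_law_integral (f : sample R V -> R) :
  measurable_fun setT f -> (forall v, 0 <= f v) ->
  (\int[P]_v (f v)%:E = (\sum_b mu b * f (X b))%:E)%E.
Proof.
move=> mf f0; rewrite P_law //; congr EFin.
by apply: eq_bigr => b _; rewrite indicE in_setT mulr1.
Qed.

Lemma cond_exp_cond_mean (D : {set V}) (f : (V -> R) -> R) :
  measurable_fun setT (f : sample R V -> R) -> (forall v, 0 <= f v) ->
  cond_exp P D f (cond_mean D (f \o X)).
Proof.
move=> mf f0.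
have g0 v : 0 <= cond_mean D (f \o X) v.
  by apply: cond_mean_ge0 => b; apply: f0.
have mg : measurable_fun setT (cond_mean D (f \o X) : sample R V -> R).
  apply: (measurable_fun_atoms (X := X)) => v v' vv'.
  apply: cond_mean_atoms => w b _.
  by rewrite vv' // finset.inE.
split.
- apply: (measurable_fun_atoms (X := X)) => v v' vv'; exact: cond_mean_atoms.
- apply/integrableP; split; first exact/measurable_EFinP.
  under eq_integral do rewrite /= ger0_norm //.
  by rewrite discrete_law_integral // ltry.
- move=> B sB; have mB := generated_coord_measurable sB.
  rewrite !P_law //; congr EFin.
  have split_ind (G : Om -> R) : \sum_b mu b * \1_B (X b) * G b =
      \sum_(b | X b \in B) mu b * G b.
    rewrite [RHS]big_mkcond; apply: eq_bigr => b _; rewrite indicE.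
    by case: (_ \in _); rewrite /= ?(mulr1, mulr0, mul0r).
  rewrite (split_ind (fun b => cond_mean D (f \o X) (X b))).
  rewrite (split_ind (f \o X)); apply: cond_mean_total => b b' bb'.
  by rewrite !inE; apply: generated_coord_saturated sB bb'.
Qed.

Lemma cond_prob_cond_mean (D : {set V}) (B : set (V -> R)) :
  measurable (B : set (sample R V)) ->
  cond_prob P D B (cond_mean D (fun b => \1_B (X b))).
Proof. by move=> mB; apply: cond_exp_cond_mean => // v; rewrite indicE. Qed.

(** The support is measurable, so its complement is a null set. *)
Lemma discrete_law_ae (Q : set (V -> R)) :
  (forall b, Q (X b)) -> {ae P, forall v, Q v}.
Proof.
move=> QX; pose S : set (sample R V) := [set v | forall b, ~ (v = X b)].
have mS : measurable S.
  apply: (measurable_set_atoms (X := X)) => v v' vv' vS b v'b; apply: (vS b).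
  apply/funext => w; apply/eqP; rewrite vv' ?finset.inE // v'b; exact/eqP.
exists S; split=> //.
  rewrite (discrete_law_prob P_law mS) big1 // => b _.
  rewrite indicE (_ : _ \in S = false) ?mulr0 //.
  by apply/negbTE; rewrite notin_setE => /(_ b).
by move=> v /= nQ b vb; apply: nQ; rewrite vb.
Qed.

End DiscreteLaw.

(** * Structural models driven by independent bits *)

Section Bits.
Variables (R : realType) (V : finType).
Local Notation bits := {ffun V -> bool}.

Definition flip (w : V) (b : bits) : bits := [ffun v => b v (+) (v == w)].

Lemma flipK w : involutive (flip w).
Proof. by move=> b; apply/ffunP => v; rewrite !ffunE addbK. Qed.

Lemma flip_at w b : flip w b w = ~~ b w.
Proof. by rewrite ffunE eqxx addbT. Qed.

Lemma flip_neq w b v : v != w -> flip w b v = b v.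
Proof. by rewrite ffunE => /negbTE ->; rewrite addbF. Qed.

Definition bits_weight (p : V -> bool -> R) (b : bits) : R :=
  \prod_v p v (b v).

Variable (p : V -> bool -> R).
Hypotheses (p_gt0 : forall v t, 0 < p v t)
  (p_sum1 : forall v, p v true + p v false = 1).
Local Notation mu := (bits_weight p).

Lemma bits_weight_gt0 b : 0 < mu b.
Proof. by apply: prodr_gt0. Qed.

Lemma bits_weight_sum1 : \sum_b mu b = 1.
Proof.
rewrite -(bigA_distr_bigA p) big1 // => v _.
by rewrite big_bool; apply: p_sum1.
Qed.

Lemma sum_flip (w : V) (H : bits -> R) :
  \sum_b H b = \sum_(b : bits | b w) (H b + H (flip w b)).
Proof.
rewrite (bigID (fun b : bits => b w)) /= big_split /=; congr (_ + _).
rewrite (reindex_inj (inv_inj (flipK w))); apply: eq_bigl => b.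
by rewrite flip_at negbK.
Qed.

(** A function of the bit of [w] is independent of a function [G] that ignores
    this bit: pairing each [b] with [flip w b] separates the two sums. *)
Lemma bit_independent (w : V) (F : bool -> R) (G : bits -> R) :
  (forall b, G (flip w b) = G b) ->
  \sum_b mu b * (F (b w) * G b) =
  (\sum_t p w t * F t) * \sum_b mu b * G b.
Proof.
move=> Gw; rewrite !(sum_flip w) mulr_sumr; apply: eq_bigr => b bw.
pose rho : R := \prod_(v | v != w) p v (b v).
have muE : mu b = p w true * rho by rewrite /bits_weight (bigD1 w) //= bw.
have mufE : mu (flip w b) = p w false * rho.
  rewrite /bits_weight (bigD1 w) //= flip_at bw; congr (_ * _).
  by apply: eq_bigr => v vw; rewrite flip_neq.
rewrite muE mufE Gw flip_at bw big_bool /= addrC.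
transitivity ((p w true * F true + p w false * F false) * (rho * G b)).
  by ring.
by rewrite -[in LHS](mul1r (rho * _)) -(p_sum1 w); ring.
Qed.

End Bits.

Section StructuralModel.
Variables (R : realType) (V : finType) (e : rel V).
Local Notation bits := {ffun V -> bool}.
Variables (p : V -> bool -> R) (X : bits -> V -> R).
Hypotheses (p_gt0 : forall v t, 0 < p v t)
  (p_sum1 : forall v, p v true + p v false = 1).
Hypothesis e_acyclic : acyclic e.
Hypothesis X_structural : forall w b b',
  (forall u, e u w -> X b u = X b' u) -> b w = b' w -> X b w = X b' w.
Hypothesis X_nd : forall w u b, u \in nd e [set w] -> X (flip w b) u = X b u.
Variable P : probability (sample R V) R.
Hypothesis P_law :
  discrete_law (bits_weight p) (X : bits -> sample R V) P.

Lemma nd1E w u : (u \in nd e [set w]%SET) = ~~ connect e w u.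
Proof.
rewrite /nd /de !finset.inE; congr (~~ _); apply/existsP/idP.
  by case=> x; rewrite !finset.inE => /andP[/eqP ->].
by move=> wu; exists w; rewrite !finset.inE eqxx.
Qed.

Lemma edge_connectF u w : e u w -> connect e w u -> False.
Proof.
move=> uw /connectP[q wq uq]; move: (@e_acyclic u (w :: q) isT).
by rewrite /dipath /= uw wq -uq eqxx.
Qed.

Lemma pa_nd w u : e u w -> u \in nd e [set w]%SET.
Proof. by move=> uw; rewrite nd1E; apply/negP; apply: edge_connectF. Qed.

(** Given the parents of [w], the vertex [w] is a function of its own bit,
    while its parents and its other nondescendants ignore this bit. *)
Lemma local_markov w : cond_indep P [set w]%SET (nd e [set w]%SET) (pa e w).
Proof.
move=> B C sB sC.
have mB := generated_coord_measurable sB.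
have mC := generated_coord_measurable sC.
have mu_gt0 := bits_weight_gt0 p_gt0.
pose g (E : set (V -> R)) :=
  cond_mean (bits_weight p) X (pa e w) (fun b => \1_E (X b)).
exists (g B), (g C), (g (B `&` C)).
split; try (apply: cond_prob_cond_mean => //; exact: measurableI).
apply: (discrete_law_ae P_law) => b0.
rewrite /g /cond_mean; set N1 := \sum_(_ | _) bits_weight p _.
have N1_neq0 : N1 != 0.
  by rewrite gt_eqF // (sum_agree_gt0 mu_gt0 (b0 := b0)) ?agree_refl.
(* [b1 t] carries the bit [t] at [w] and gives the parents of [w] the values
   that they have under [b0]; hence [beta] expresses [B] by the bit of [w]. *)
pose b1 t := if t == b0 w then b0 else flip w b0.
pose beta t : R := \1_B (X (b1 t)).
have b1_at t : b1 t w = t.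
  by rewrite /b1; case: eqP => // /eqP; rewrite flip_at; case: t (b0 w) => -[].
have b1_nd t u : u \in nd e [set w]%SET -> X (b1 t) u = X b0 u.
  by rewrite /b1; case: ifP => // _ /X_nd.
have betaE b : agree (pa e w) (X b0) (X b) -> \1_B (X b) = beta (b w).
  move=> /agreeP bb0.
  have bw : agree [set w]%SET (X b) (X (b1 (b w))).
    apply/agreeP => _ /set1P ->; apply: X_structural => [u uw|]; last first.
      by rewrite b1_at.
    by rewrite b1_nd ?pa_nd // bb0 // finset.inE.
  rewrite /beta !indicE; congr (_%:R); congr (nat_of_bool _).
  apply/idP/idP; rewrite !inE; apply: generated_coord_saturated sB _ => //.
  by rewrite agree_sym.
pose G (E : bits -> R) b : R := (agree (pa e w) (X b0) (X b))%:R * E b.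
have NE E : \sum_(b | agree (pa e w) (X b0) (X b)) bits_weight p b * E b =
    \sum_b bits_weight p b * G E b.
  rewrite [LHS]big_mkcond; apply: eq_bigr => b _; rewrite /G.
  by case: (agree _ _ _); rewrite ?(mul1r, mul0r, mulr0).
have indep E : (forall b, G E (flip w b) = G E b) ->
    \sum_(b | agree (pa e w) (X b0) (X b))
      bits_weight p b * (\1_B (X b) * E b) =
    (\sum_t p w t * beta t) *
    \sum_(b | agree (pa e w) (X b0) (X b)) bits_weight p b * E b.
  move=> GE; rewrite !NE -bit_independent //; apply: eq_bigr => b _.
  congr (_ * _); rewrite /G; case bb0 : (agree _ _ _); last first.
    by rewrite !mul0r mulr0.
  by rewrite !mul1r betaE.
have agree_flip b : agree (pa e w) (X b0) (X (flip w b)) =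
    agree (pa e w) (X b0) (X b).
  rewrite agree_sym [RHS]agree_sym; apply: agree_trans; apply/agreeP => u.
  by rewrite finset.inE => /pa_nd /X_nd.
have C_flip b : \1_C (X (flip w b)) = \1_C (X b) :> R.
  rewrite !indicE; congr (_%:R); congr (nat_of_bool _).
  have fb : agree (nd e [set w]%SET) (X (flip w b)) (X b).
    by apply/agreeP => u; apply: X_nd.
  apply/idP/idP; rewrite !inE; apply: generated_coord_saturated sC _ => //.
  by rewrite agree_sym.
have := indep (fun=> 1); have := indep (fun b => \1_C (X b)).
rewrite (eq_bigr (fun b => bits_weight p b * \1_(B `&` C) (X b))); last first.
  by move=> b _; rewrite !indicE in_setI -mulnb natrM.
rewrite (eq_bigr (fun b => bits_weight p b * \1_B (X b))
  (F1 := fun b => _ * (_ * 1))); last first.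
  by move=> b _; rewrite mulr1.
rewrite (eq_bigr (bits_weight p) (F1 := fun b => _ * 1)); last first.
  by move=> b _; rewrite mulr1.
move=> -> => [->|b]; last by rewrite /G agree_flip C_flip.
  rewrite -/N1; field.
  exact: N1_neq0.
by move=> b; rewrite /G agree_flip.
Qed.

Lemma bits_bayes_net (A : V) (TA : {fset R}) :
  (forall b, X b A \in TA) -> bayes_net e A TA P.
Proof.
move=> XA; split; last exact: local_markov.
  (* The law is its own dominating measure. *)
  exists P, (cst 1%E); split=> // B mB.
  by rewrite (@integral_cst _ _ _ P B mB 1) mul1e.
rewrite (discrete_law_prob P_law).
  rewrite -(bits_weight_sum1 p_sum1); congr EFin; apply: eq_bigr => b _.
  by rewrite indicE mem_set ?mulr1 //; apply: XA.
apply: (@measurable_coord R V [set: V]%SET A [set` TA]).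
  by rewrite finset.inE.
apply: countable_measurable => [x|]; first exact: measurable_set1.
exact/finite_set_countable/finite_fset.
Qed.

End StructuralModel.

(** * The adjustment formula in a structural model *)

Section AdjustmentInModel.
Variables (R : realType) (V : finType) (e : rel V).
Local Notation bits := {ffun V -> bool}.
Variables (p : V -> bool -> R) (X : bits -> V -> R).
Hypotheses (p_gt0 : forall v t, 0 < p v t)
  (p_sum1 : forall v, p v true + p v false = 1).
Hypothesis e_acyclic : acyclic e.
Hypothesis X_structural : forall w b b',
  (forall u, e u w -> X b u = X b' u) -> b w = b' w -> X b w = X b' w.
Hypothesis X_nd : forall w u b, u \in nd e [set w]%SET -> X (flip w b) u = X b u.
Variables (A Y : V) (TA : {fset R}) (L N Z : {set V}) (a0 a1 y : R).
Variable (h : bits -> bool).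
Let level t := if t then a1 else a0.
Hypotheses (a0_TA : a0 \in TA) (a1_TA : a1 \in TA) (a1_neq0 : a1 != a0).
Hypothesis X_A : forall b, exists t, X b A = level t.
Hypothesis h_L : forall b b', agree L (X b) (X b') -> h b = h b'.

(** The chosen treatment [level (h b)] is possible whatever the values on [D]
    are; this gives the positivity condition. *)
Definition overlap (D : {set V}) :=
  forall b, exists2 b', agree D (X b) (X b') & X b' A = level (h b).

Local Notation mu := (bits_weight p).
Let f (b : bits) : R := (X b Y <= y)%R%:R.

(* The values on [L] for which [h] selects [a1]; the law [q] is the point mass
   at the selected level. *)
Let S : set (V -> R) := [set v | exists2 b, h b & agree L v (X b)].

Let q (a : R) (v : V -> R) : R :=
  if a == a1 then \1_S v else if a == a0 then 1 - \1_S v else 0.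

Let S_atoms (v v' : V -> R) :
  (forall w b, w \in L -> (v w == X b w) = (v' w == X b w)) -> S v = S v'.
Proof.
move=> vv'; apply/propext; split=> -[b hb vb]; exists b => //.
  by rewrite -(agree_atoms _ vv').
by rewrite (agree_atoms _ vv').
Qed.

Let q_atoms a (v v' : V -> R) :
  (forall w b, w \in L -> (v w == X b w) = (v' w == X b w)) -> q a v = q a v'.
Proof.
move=> vv'; rewrite /q !indicE (_ : (v \in S) = (v' \in S)) //.
by apply/idP/idP; rewrite !inE (S_atoms vv').
Qed.

Let q_model a b : q a (X b) = (a == level (h b))%:R.
Proof.
have SX : \1_S (X b) = (h b)%:R :> R.
  rewrite indicE; congr (_%:R); congr (nat_of_bool _).
  apply/idP/idP; first by rewrite inE => -[b' hb' /h_L ->].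
  by move=> hb; rewrite inE; exists b => //; apply: agree_refl.
rewrite /q SX /level; case: (h b) => /=; case: ifP => a_a1 //.
- by rewrite subrr if_same.
- by rewrite (eqP a_a1) (negbTE a1_neq0).
- by rewrite subr0; case: eqP.
Qed.

Let q_law : cond_law L TA q.
Proof.
have ind01 v : 0 <= (\1_S v : R) <= 1.
  rewrite indicE; case: (_ \in _) => /=; apply/andP; split;
    by rewrite ?ler01 ?lexx.
move=> a aTA; split=> [|v|v].
- by apply: (measurable_fun_atoms (X := X)) => v v'; apply: q_atoms.
- rewrite /q; have := ind01 v; case: ifP => _; first by lra.
  by case: ifP => _; lra.
- rewrite (bigD1_seq a1) ?fset_uniq //= -big_filter.
  rewrite (bigD1_seq a0) ?filter_uniq ?fset_uniq //=; last first.
    by rewrite mem_filter eq_sym a1_neq0.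
  rewrite big_seq_cond big1 => [|a']; last first.
    rewrite mem_filter => /andP[/andP[/negbTE a'1 _] /negbTE a'0].
    by rewrite /q a'1 a'0.
  by rewrite /q !eqxx eq_sym (negbTE a1_neq0) addr0 subrKC.
Qed.

Variable P : probability (sample R V) R.
Hypothesis P_law : discrete_law mu (X : bits -> sample R V) P.

Let mu_gt0 := bits_weight_gt0 p_gt0.

Let overlap_positivity (D : {set V}) : overlap D -> positivity P A TA q D.
Proof.
move=> ovl a aTA.
have mA : measurable ([set v | v A = a] : set (sample R V)).
  by apply: (@measurable_coord R V [set: V]%SET A [set a]) => //;
    rewrite finset.inE.
exists (cond_mean mu X D (fun b => \1_[set v | v A = a] (X b))).
  exact: (cond_prob_cond_mean mu_gt0 P_law).
apply: (discrete_law_ae P_law) => b; rewrite q_model.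
case: eqP => [->|_]; last by rewrite ltxx.
move=> _; have [b' bb' b'A] := ovl b; rewrite /cond_mean divr_gt0 //.
  rewrite (bigD1 b') //= indicE mem_set //= mulr1 ltr_pwDl // sumr_ge0 // => b'' _.
  by rewrite mulr_ge0 ?indicE // ltW.
exact: sum_agree_gt0 bb'.
Qed.

Let mean_cond_mean (D : {set V}) :
  adjusted_mean P A TA q (cond_mean mu X D f) =
  (\sum_b mu b * cond_mean mu X D f (set_coord A (level (h b)) (X b)))%:E.
Proof.
have f0 b : 0 <= f b by rewrite /f ler0n.
have m0 v : 0 <= cond_mean mu X D f v by apply: cond_mean_ge0.
rewrite /adjusted_mean (discrete_law_integral P_law); last 2 first.
- apply: (measurable_fun_atoms (X := X)) => v v' vv'; apply: eq_bigr => a _.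
  congr (_ * _); first by apply: q_atoms => w b _; apply: vv'; rewrite finset.inE.
  apply: cond_mean_atoms => w b _; rewrite /set_coord; case: ifP => // _.
  by apply: vv'; rewrite finset.inE.
- move=> v; rewrite big_seq sumr_ge0 // => a aTA.
  by rewrite mulr_ge0 //; have [_] := q_law aTA.
congr EFin; apply: eq_bigr => b _; congr (_ * _).
have lvl_TA : level (h b) \in TA by rewrite /level; case: ifP.
rewrite (bigD1_seq _ lvl_TA) ?fset_uniq //= q_model eqxx mul1r.
rewrite big1 ?addr0 // => a /negbTE a_lvl.
by rewrite q_model a_lvl mul0r.
Qed.

(** The defining equality of an adjustment set, in the form of two finite sums,
    for the treatment rule [h] that reads the coordinates in [L]. *)
Lemma adjustment_set_model_eq :
  adjustment_set e A Y TA L N Z ->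
  overlap (pa e A :|: L)%SET -> overlap Z ->
  \sum_b mu b * cond_mean mu X (A |: (pa e A :|: L))%SET f
    (set_coord A (level (h b)) (X b)) =
  \sum_b mu b * cond_mean mu X (A |: Z)%SET f
    (set_coord A (level (h b)) (X b)).
Proof.
move=> [_ _ _ adj] ovl_pa ovl_Z; apply: EFin_inj; rewrite -!mean_cond_mean.
have mY : measurable ([set v | v Y <= y] : set (sample R V)).
  apply: (@measurable_coord R V [set: V]%SET Y [set x | x <= y]).
    by rewrite finset.inE.
  rewrite (_ : [set _ | _] = `]-oo, y]%classic); first exact: measurable_itv.
  by apply/seteqP; split=> x /=; rewrite in_itv.
have version D : cond_exp P D \1_[set v | v Y <= y] (cond_mean mu X D f).
  rewrite (_ : f = (\1_[set v | v Y <= y] \o X)).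
    by apply: cond_exp_cond_mean => //= v; rewrite indicE.
  by apply/funext => b; rewrite /f /= indicE mem_setE.
apply: (adj q P y) => //.
- apply: (bits_bayes_net p_gt0 p_sum1 e_acyclic X_structural X_nd P_law) => b.
  by have [t ->] := X_A b; rewrite /level; case: t.
- exact: overlap_positivity.
- exact: overlap_positivity.
Qed.

End AdjustmentInModel.

Local Close Scope classical_set_scope.

(** * Adjustment sets contain no forbidden vertex *)

Section Coins.
Variables (R : realType) (V : finType) (w0 : V).
Local Notation bits := {ffun V -> bool}.

(** The bias of [w0] is what separates the two sides of the adjustment formula:
    in the models below they would agree if all coins were fair. *)
Definition coin (v : V) (t : bool) : R :=
  if v == w0 then if t then 1 / 4 else 3 / 4 else 1 / 2.

Lemma coin_gt0 v t : 0 < coin v t.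
Proof. by rewrite /coin; case: ifP => _; case: t; lra. Qed.

Lemma coin_sum1 v : coin v true + coin v false = 1.
Proof. by rewrite /coin; case: ifP => _; lra. Qed.

Lemma coin_weight_eq (b b' : bits) :
  b w0 = b' w0 -> bits_weight coin b = bits_weight coin b'.
Proof.
move=> bb'; apply: eq_bigr => v _; rewrite /coin.
by case: eqP => // ->; rewrite bb'.
Qed.

(** A bijection of the sample space that preserves the weights and exchanges
    [Q] with its negation shows that [Q] has probability 1/2. *)
Lemma coin_balanced (tau : bits -> bits) (Q : pred bits) :
  injective tau -> (forall b, tau b w0 = b w0) ->
  (forall b, Q (tau b) = ~~ Q b) ->
  \sum_b bits_weight coin b * (Q b)%:R = 1 / 2.
Proof.
move=> tau_inj tau_w0 Qtau; set s := LHS.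
have s_compl : s = \sum_b bits_weight coin b * (1 - (Q b)%:R).
  rewrite /s (reindex_inj tau_inj); apply: eq_bigr => b _.
  rewrite (coin_weight_eq (tau_w0 b)) Qtau; congr (_ * _).
  by case: (Q b); rewrite ?subrr ?subr0.
have : s + s = 1.
  rewrite {2}s_compl /s -big_split /= -[RHS](bits_weight_sum1 coin_sum1).
  by apply: eq_bigr => b _; rewrite -mulrDr subrKC mulr1.
by lra.
Qed.

End Coins.

Lemma cond_mean_const (R : realType) (V Om : finType) (mu : Om -> R)
    (X : Om -> V -> R) (D : {set V}) (F : Om -> R) (v : V -> R) (k : R) b0 :
  (forall b, 0 < mu b) -> agree D v (X b0) ->
  (forall b, agree D v (X b) -> F b = k) ->
  cond_mean mu X D F v = k.
Proof.
move=> mu_gt0 vb0 Fk; rewrite /cond_mean.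
rewrite (eq_bigr (fun b => mu b * k)) => [|b /Fk -> //].
rewrite -mulr_suml mulrAC mulfV ?mul1r // gt_eqF //.
exact: sum_agree_gt0 vb0.
Qed.

Lemma set_coord_agree (R : realType) (V : finType) (A : V) (D : {set V})
    (a : R) (v v' : V -> R) : A \notin D ->
  agree (A |: D) (set_coord A a v) v' = (v' A == a) && agree D v v'.
Proof.
move=> AD; apply/agreeP/andP => [H|[/eqP v'A /agreeP H] w].
  split; first by rewrite -H ?finset.setU11 // /set_coord eqxx.
  apply/agreeP => w wD; rewrite -H ?finset.setU1r // /set_coord.
  by case: eqP wD => // ->; rewrite (negbTE AD).
rewrite /set_coord => /setU1P[->|wD]; first by rewrite eqxx.
by case: eqP => [->|_]; rewrite ?H.
Qed.

(** A forbidden vertex [F] in [Z] descends, like [Y], from a child [v1] of [A].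
    In the model where [v1] is a noisy copy of [A] that all descendants of [v1]
    repeat, the outcome is determined by the value at [F], so that adjusting
    for [Z] hides the effect of [A] on [Y]. *)
Lemma adjustment_set_not_forb (R : realType) (V : finType) (e : rel V)
    (A Y : V) (TA : {fset R}) (L N Z : {set V}) (a0 a1 : R) :
  acyclic e -> a0 \in TA -> a1 \in TA -> a1 != a0 ->
  L \subset nd e [set A] ->
  adjustment_set e A Y TA L N Z -> [disjoint Z & forb e A Y].
Proof.
move=> e_acyclic a0_TA a1_TA a1_neq0 L_nd adj.
rewrite disjoint_subset; apply/fintype.subsetP => F FZ; apply/negP.
have [/fintype.subsetP ZAY _ _ _] := adj.
have neqA u : u \in Z -> u != A.
  by move=> /ZAY; rewrite !finset.inE negb_or => /andP[].
rewrite !finset.inE (negbTE (neqA F FZ)) orbF => /existsP[w].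
rewrite finset.inE => /andP[/andP[wA /asboolP[pt /andP[Apt /eqP Yl] wpt]] wF].
move: wpt; rewrite in_cons (negbTE wA) /=.
case: pt Apt Yl => [//|v1 pt] /= /andP[Av1 v1pt] Yl wpt.
have v1Y : connect e v1 Y by apply/connectP; exists pt.
have v1F : connect e v1 F.
  by apply: connect_trans wF; apply: (path_connect v1pt).
have v1A : connect e v1 A = false.
  by apply/negP; apply: edge_connectF.
have v1A_neq : v1 != A by apply: contraFneq v1A => ->.
have AY : Y != A by apply: contraFneq v1A => <-.
pose p := coin R v1.
pose level t := if t then a1 else a0.
have level_inj : injective level.
  by move=> [] [] //= H; move: a1_neq0; rewrite H eqxx.
pose X (b : {ffun V -> bool}) w : R :=
  if w == A then level (b A)
  else if connect e v1 w then (b A (+) b v1)%:R else 0.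
have XA b : X b A = level (b A) by rewrite /X eqxx.
have Xde b w' : connect e v1 w' -> X b w' = (b A (+) b v1)%:R.
  by move=> v1w; rewrite /X; case: eqP v1w => [->|_ ->]; rewrite ?v1A.
have Xnd_const b b' w' : w' \in nd e [set A] -> X b w' = X b' w'.
  rewrite nd1E /X; case: eqP => [->|_]; first by rewrite connect0.
  by case: ifP => // v1w; rewrite (connect_trans (connect1 Av1) v1w).
have X_structural w' b b' :
    (forall u, e u w' -> X b u = X b' u) -> b w' = b' w' -> X b w' = X b' w'.
  move=> Xpa bw'; rewrite [LHS]/X [RHS]/X; case: eqP => [<-|_]; first by rewrite bw'.
  case: ifP => // /connectP[q]; case/lastP: q => [_ /= w'v1|q x].
    have /level_inj bA : level (b A) = level (b' A) by rewrite -!XA Xpa // w'v1.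
    by rewrite bA -w'v1 bw'.
  rewrite rcons_path last_rcons => /andP[v1q qx] w'x.
  rewrite -w'x in qx; rewrite -(Xde b (last v1 q)) ?(Xpa _ qx) ?Xde //;
    by apply/connectP; exists q.
have X_nd w' u b : u \in nd e [set w'] -> X (flip w' b) u = X b u.
  rewrite nd1E /X => w'u; case: eqP w'u => [->|_] w'u.
    by rewrite flip_neq //; apply: contraNneq w'u => ->; apply: connect0.
  case: ifP => // v1u; rewrite !flip_neq //; apply: contraNneq w'u => <- //.
  exact: connect_trans (connect1 Av1) v1u.
have X_A b : exists t, X b A = level t by exists (b A).
have mu_gt0 : forall b, 0 < bits_weight p b.
  by apply: bits_weight_gt0; apply: coin_gt0.
have mu_sum1 : \sum_b bits_weight p b = 1.
  by apply: bits_weight_sum1; apply: coin_sum1.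
have [P P_law] := discrete_law_exists (X : _ -> sample R V)
  (fun b => ltW (mu_gt0 b)) mu_sum1.
have pa_L_nd u : u \in pa e A :|: L -> u \in nd e [set A].
  rewrite finset.inE => /orP[|/(fintype.subsetP L_nd)//].
  by rewrite finset.inE => /pa_nd; apply.
have agree_pa b b' : agree (pa e A :|: L) (X b) (X b').
  by apply/agreeP => u /pa_L_nd; apply: Xnd_const.
have ovl_pa : overlap X A a0 a1 xpredT (pa e A :|: L).
  move=> b; exists [ffun=> true] => //; by rewrite XA ffunE.
have ovl_Z : overlap X A a0 a1 xpredT Z.
  (* Flipping the bit of v1 as well compensates the change at A. *)
  move=> b; exists (if b A then b else flip A (flip v1 b)); last first.
    rewrite XA; case: ifP => bA; first by rewrite bA.
    by rewrite flip_at flip_neq ?bA // eq_sym.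
  apply/agreeP => u /neqA /negbTE uA; case: ifP => // _; rewrite /X uA.
  case: ifP => // _; rewrite flip_at [flip A _ v1]flip_neq // flip_at.
  by rewrite flip_neq 1?eq_sym // addbN addNb negbK.
have := adjustment_set_model_eq (@coin_gt0 R V v1) (@coin_sum1 R V v1)
  e_acyclic X_structural X_nd (1 / 2) a0_TA a1_TA a1_neq0 X_A
  (h := xpredT) (fun _ _ _ => erefl) P_law adj ovl_pa ovl_Z.
have fE b : (X b Y <= 1 / 2) = ~~ (b A (+) b v1).
  rewrite Xde //; case: (_ (+) _) => /=; last by lra.
  by apply/negbTE; rewrite -ltNge; lra.
(* The parents of A and the vertices of L are constant, so that conditioning on
   them and on A amounts to fixing the bit of A. *)
rewrite (eq_bigr (fun b => bits_weight p b * (1 / 4))); last first.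
  move=> b _; congr (_ * _); rewrite /cond_mean.
  have agE b' : agree (A |: (pa e A :|: L)) (set_coord A a1 (X b)) (X b') = b' A.
    rewrite set_coord_agree; last first.
      by apply/negP => /pa_L_nd; rewrite nd1E connect0.
    rewrite agree_pa andbT XA /level; case: (b' A); rewrite ?eqxx //.
    by rewrite eq_sym (negbTE a1_neq0).
  rewrite !(eq_bigl _ _ agE).
  have -> : \sum_(b' : {ffun V -> bool} | b' A)
        bits_weight p b' * (X b' Y <= 1 / 2)%R%:R =
      \sum_b' bits_weight p b' * ((b' v1)%:R * (b' A)%:R).
    rewrite big_mkcond; apply: eq_bigr => b' _; rewrite fE.
    by case: (b' A); rewrite ?mulr0 //= negbK mulr1.
  have -> : \sum_(b' : {ffun V -> bool} | b' A) bits_weight p b' =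
      \sum_b' bits_weight p b' * (b' A)%:R.
    rewrite big_mkcond; apply: eq_bigr => b' _.
    by case: (b' A); rewrite ?mulr0 ?mulr1.
  rewrite (bit_independent (@coin_sum1 R V v1) (w := v1) (fun t => t%:R)
    (G := fun b => (b A)%:R)); last by move=> b'; rewrite flip_neq 1?eq_sym.
  rewrite mulfK; last first.
    rewrite gt_eqF // (bigD1 [ffun=> true]) //= ffunE mulr1 ltr_pwDl //.
    by rewrite sumr_ge0 // => b' _; rewrite mulr_ge0 // ltW.
  by rewrite big_bool /p /coin eqxx /= mulr0 addr0 mulr1.
(* On the other side, the value at F determines the outcome. *)
rewrite -mulr_suml mu_sum1 mul1r.
rewrite (eq_bigr (fun b => bits_weight p b * (~~ (b A (+) b v1))%:R)); last first.
  move=> b _; congr (_ * _); have [b0 bb0 b0A] := ovl_Z b.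
  have AZ : A \notin Z by apply/negP => /neqA; rewrite eqxx.
  apply: (cond_mean_const (b0 := b0)) => //.
    by rewrite set_coord_agree // bb0 b0A eqxx.
  move=> b'; rewrite set_coord_agree // => /andP[_ /agreeP /(_ F FZ)].
  rewrite fE !Xde // => /eqP; rewrite eqr_nat.
  by case: (_ (+) _); case: (_ (+) _).
rewrite (@coin_balanced _ _ _ (flip A)).
- by lra.
- exact: inv_inj (flipK A).
- by move=> b; rewrite flip_neq.
- by move=> b; rewrite flip_at flip_neq // addNb.
Qed.

(** * Adjustment sets block the walks of H0 *)

Section BackdoorGraph.
Variables (V : finType) (e : rel V) (A Y : V) (L : {set V}).
Hypotheses (e_acyclic : acyclic e) (AY : connect e A Y) (A_neq_Y : A != Y).
Hypothesis L_nd : L \subset nd e [set A].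

Definition backdoor_graph : rel V := Defs.induced (anAYL e A Y L) (pbd e A Y).
Local Notation G := backdoor_graph.

Lemma anAYLP w :
  reflect (exists2 t, t \in [set A; Y] :|: L & connect e w t)
          (w \in anAYL e A Y L).
Proof.
rewrite finset.inE; apply: (iffP existsP) => [[t /andP[]]|[t tA wt]].
  by exists t.
by exists t; rewrite tA.
Qed.

Lemma backdoor_graph_sub u w : G u w -> e u w.
Proof. by move=> /and3P[_ _ /andP[]]. Qed.

Lemma backdoor_connect_sub u w : connect G u w -> connect e u w.
Proof.
by apply: connect_sub => ? ? /backdoor_graph_sub; apply: connect1.
Qed.

Lemma L_not_descendant l : l \in L -> ~~ connect e A l.
Proof. by move=> /(fintype.subsetP L_nd); rewrite nd1E. Qed.

(** A child of [A] that is an ancestor of [A], of [Y] or of [L] would close a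
    cycle, would start a directed path to [Y], whose first edge is removed, or
    would make a vertex of [L] a descendant of [A]. *)
Lemma backdoor_sinkA w : G A w = false.
Proof.
apply/negP => /and3P[_ /anAYLP[t tA wt] /andP[Aw]]; rewrite eqxx /= => /negP; apply.
apply/asboolP; move: tA; rewrite !finset.inE => /orP[/orP[/eqP tE|/eqP tE]|tL].
- by case: (edge_connectF e_acyclic Aw); rewrite -tE.
- move: wt; rewrite tE => /connectP[q wq Yq].
  by exists q; rewrite /dipath /= Aw wq -Yq eqxx.
- by case/negP: (L_not_descendant tL); apply: connect_trans (connect1 Aw) wt.
Qed.

Lemma backdoor_sinkY w : G Y w = false.
Proof.
apply/negP => /and3P[_ /anAYLP[t tA wt] /andP[Yw _]].
move: tA; rewrite !finset.inE => /orP[/orP[/eqP tE|/eqP tE]|tL].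
- by case: (edge_connectF e_acyclic Yw); rewrite tE in wt; apply: connect_trans wt AY.
- by case: (edge_connectF e_acyclic Yw); rewrite -tE.
- case/negP: (L_not_descendant tL); apply: connect_trans AY _.
  exact: connect_trans (connect1 Yw) wt.
Qed.

Lemma sink_connect (g : rel V) s t : (forall w, g s w = false) ->
  connect g s t -> t = s.
Proof. by move=> gs /connectP[[|x q] //= /andP[]]; rewrite gs. Qed.

(** Removing edges does not destroy the ancestral relations to [A], [Y] and [L]:
    a directed path can only lose an edge that leaves [A], and it may then be
    stopped at [A]. *)
Lemma backdoor_reach x : x \in anAYL e A Y L ->
  exists2 t, t \in [set A; Y] :|: L & connect G x t.
Proof.
move=> /anAYLP[t tA /connectP[q]].
elim: q x => [|x' q IH] x /=; first by move=> _ <-; exists t.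
move=> /andP[xx' x'q] tE; have [t' t'A x't'] := IH _ x'q tE.
case: (boolP (pbd e A Y x x')) => [xx'G|]; last first.
  rewrite /pbd xx' /= negbK => /andP[/eqP -> _].
  by exists A; rewrite ?connect0 // !finset.inE eqxx.
exists t' => //; apply: connect_trans (connect1 _) x't'.
rewrite /G /Defs.induced xx'G andbT; apply/andP; split; apply/anAYLP; exists t => //.
  by apply/connectP; exists (x' :: q) => //=; rewrite xx'.
by apply/connectP; exists q.
Qed.

End BackdoorGraph.

Section Parity.
Variable (V : finType).
Local Notation bits := {ffun V -> bool}.

Definition parity (s : seq (V * V)) (b : bits) : bool :=
  \big[addb/false]_(i <- s) (b i.1 (+) b i.2).

Lemma eq_parity s (b b' : bits) :
  (forall i, i \in s -> b i.1 (+) b i.2 = b' i.1 (+) b' i.2) ->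
  parity s b = parity s b'.
Proof. by move=> bb'; apply: eq_big_seq. Qed.

Lemma parity_cons i s (b : bits) :
  parity (i :: s) b = (b i.1 (+) b i.2) (+) parity s b.
Proof. by rewrite /parity big_cons. Qed.

Definition complement (b : bits) : bits := [ffun v => ~~ b v].

Lemma complementK : involutive complement.
Proof. by move=> b; apply/ffunP => v; rewrite !ffunE negbK. Qed.

Lemma complement_diff (b : bits) u w :
  complement b u (+) complement b w = b u (+) b w.
Proof. by rewrite !ffunE addbN addNb negbK. Qed.

Lemma coin_weight_complement (R : realType) w0 (b : bits) : b w0 ->
  bits_weight (coin R w0) (complement b) = 3 * bits_weight (coin R w0) b.
Proof.
move=> bw0; rewrite /bits_weight (bigD1 w0) //= [in RHS](bigD1 w0) //= mulrA.
rewrite /coin eqxx ffunE bw0 /=; congr (_ * _); first by lra.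
by apply: eq_bigr => v /negbTE ->.
Qed.

End Parity.

Section BackdoorModel.
Variables (R : realType) (V : finType) (e : rel V) (A Y : V) (L Z : {set V}).
Local Notation bits := {ffun V -> bool}.
Hypotheses (e_acyclic : acyclic e) (AY : connect e A Y) (A_neq_Y : A != Y).
Hypothesis L_nd : L \subset nd e [set A].
Hypotheses (A_Z : A \notin Z) (Y_Z : Y \notin Z) (L_Z : L \subset Z).
Local Notation G := (backdoor_graph e A Y L).

Let L_neqA l : l \in L -> l != A.
Proof. by move=> lL; apply: contraNneq A_Z => <-; apply: (fintype.subsetP L_Z). Qed.

Let L_neqY l : l \in L -> l != Y.
Proof. by move=> lL; apply: contraNneq Y_Z => <-; apply: (fintype.subsetP L_Z). Qed.

(** [x] has access to its own bit and to those of its parents, except for the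
    bits of the vertices of [Z], which are concealed. *)
Definition hears (x u : V) := ((u == x) || G u x) && (u \notin Z).

(** The difference of the two bits of [i] is computed at a vertex [x] and passed
    on along the edges from [x] to [w]. *)
Definition knows (w : V) (i : V * V) :=
  [exists x, [&& connect G x w, hears x i.1 & hears x i.2]].

Lemma knowsP w i :
  reflect (exists2 x, connect G x w & hears x i.1 && hears x i.2) (knows w i).
Proof.
apply: (iffP existsP) => -[x]; first by case/andP; exists x.
by move=> xw xi; exists x; rewrite xw.
Qed.

Lemma moral_step u u' : H0 e A Y L u u' -> u \notin Z -> u' \notin Z ->
  exists2 x, x \in anAYL e A Y L & hears x u && hears x u'.
Proof.
have G_an v v' : G v v' -> v' \in anAYL e A Y L by case/and3P.
move=> /andP[_ /or3P[uu'|u'u|/existsP[x /andP[ux u'x]]]] uZ u'Z.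
- by exists u'; [exact: G_an uu'|rewrite /hears (uu' : G u u') eqxx orbT uZ u'Z].
- by exists u; [exact: G_an u'u|rewrite /hears (u'u : G u' u) eqxx orbT uZ u'Z].
- exists x; first exact: G_an ux.
  by rewrite /hears (ux : G u x) (u'x : G u' x) !orbT uZ u'Z.
Qed.

(** Each step of the walk is assigned to [A], to [Y] or to a vertex of [L] that
    knows the difference of its two bits, and these differences telescope. *)
Lemma walk_parities u q :
  path (H0 e A Y L) u q -> (forall v, v \in u :: q -> v \notin Z) ->
  exists sA sY sL, [/\ all (knows A) sA, all (knows Y) sY,
    all (fun i => [exists l in L, knows l i]) sL &
    forall b, parity sA b (+) parity sY b (+) parity sL b = b u (+) b (last u q)].
Proof.
elim: q u => [|u' q IH] u /=.
  move=> _ _; exists [::], [::], [::]; split=> // b.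
  by rewrite /parity !big_nil !addbb.
move=> /andP[uu' u'q] nZ.
have [|sA [sY [sL [kA kY kL sE]]]] := IH _ u'q.
  by move=> v vq; apply: nZ; rewrite in_cons vq orbT.
have uZ : u \notin Z by apply: nZ; rewrite mem_head.
have u'Z : u' \notin Z by apply: nZ; rewrite in_cons mem_head orbT.
have [x /(backdoor_reach (e := e))[t tAYL xt] xuu'] := moral_step uu' uZ u'Z.
have kt : knows t (u, u') by apply/knowsP; exists x.
have step b : b u (+) b (last u' q) =
    (b u (+) b u') (+) (b u' (+) b (last u' q)) by rewrite addbA addbK.
move: tAYL; rewrite !finset.inE => /orP[/orP[/eqP tE|/eqP tE]|tL].
- exists ((u, u') :: sA), sY, sL; split; rewrite /= -?tE ?kt //= ?tE // => b.
  by rewrite step -sE parity_cons !addbA.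
- exists sA, ((u, u') :: sY), sL; split; rewrite /= -?tE ?kt //= ?tE // => b.
  by rewrite step -sE parity_cons addbCA -!addbA.
- exists sA, sY, ((u, u') :: sL); split=> //=.
    by rewrite kL andbT; apply/existsP; exists t; rewrite tL.
  by move=> b; rewrite step -sE parity_cons addbCA.
Qed.

Variables (a0 a1 : R).
Hypothesis a1_neq0 : a1 != a0.
Variables (sA sY sL : seq (V * V)).
Hypotheses (sA_A : all (knows A) sA) (sY_Y : all (knows Y) sY)
  (sL_L : all (fun i => [exists l in L, knows l i]) sL).
Hypothesis parityE : forall b,
  parity sA b (+) parity sY b (+) parity sL b = b A (+) b Y.

Let level t := if t then a1 else a0.

(** The vertices of [Z] conceal their own bits, so that adjusting for [Z] reveals
    differences of bits only. *)
Definition knowledge (w : V) (b : bits) : {ffun V * V -> bool} * bool :=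
  ([ffun i => knows w i && (b i.1 (+) b i.2)], (w \notin Z) && b w).

(** [A] and [Y] have no children in the graph that carries the model, so they
    can be reduced to a single bit. *)
Definition backdoor_model (b : bits) (w : V) : R :=
  if w == A then level (parity sA b)
  else if w == Y then (parity sY b (+) b Y)%:R
  else (choice.pickle (knowledge w b))%:R.
Local Notation X := backdoor_model.

Lemma level_inj : injective level.
Proof. by move=> [] [] //= H; move: a1_neq0; rewrite H eqxx. Qed.

Lemma backdoor_modelA b : X b A = level (parity sA b).
Proof. by rewrite /X eqxx. Qed.

Lemma backdoor_modelY b : X b Y = (parity sY b (+) b Y)%:R.
Proof. by rewrite /X eq_sym (negbTE A_neq_Y) eqxx. Qed.

Lemma backdoor_model_reads w b b' : w != A -> w != Y -> X b w = X b' w ->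
  (forall i, knows w i -> b i.1 (+) b i.2 = b' i.1 (+) b' i.2) /\
  (w \notin Z -> b w = b' w).
Proof.
move=> /negbTE wA /negbTE wY; rewrite /X wA wY => /eqP; rewrite eqr_nat.
move=> /eqP/(pcan_inj choice.pickleK)[/ffunP kE rE]; split=> [i wi|wZ].
  by have := kE i; rewrite !ffunE wi.
by move: rE; rewrite wZ.
Qed.

Lemma parent_not_sink u w : G u w -> (u != A) && (u != Y).
Proof.
by move=> uw; apply/andP; split; apply/eqP => uE; move: uw;
  rewrite uE ?backdoor_sinkA ?backdoor_sinkY.
Qed.

(** A difference known by [w] is either computed at [w], from its own bit and
    the bits revealed by its parents, or known by a parent. *)
Lemma knows_from_parents w b b' i :
  (forall u, e u w -> X b u = X b' u) -> b w = b' w -> knows w i ->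
  b i.1 (+) b i.2 = b' i.1 (+) b' i.2.
Proof.
have heard v : hears w v -> (forall u, e u w -> X b u = X b' u) ->
    b w = b' w -> b v = b' v.
  move=> /andP[/orP[/eqP -> //|vw] vZ] Xpa _.
  have /andP[vA vY] := parent_not_sink vw.
  have [_] := backdoor_model_reads vA vY (Xpa v (backdoor_graph_sub vw)).
  by apply.
move=> Xpa bw /knowsP[x /connectP[q]]; case/lastP: q => [_ /= wx|q y].
  by rewrite -wx => /andP[/heard -> // /heard ->].
rewrite rcons_path last_rcons => /andP[xq qy] wE xi; rewrite -{}wE in qy.
have /andP[vA vY] := parent_not_sink qy.
have [+ _] := backdoor_model_reads vA vY (Xpa _ (backdoor_graph_sub qy)).
by apply; apply/knowsP; exists x => //; apply/connectP; exists q.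
Qed.

Lemma backdoor_model_structural w b b' :
  (forall u, e u w -> X b u = X b' u) -> b w = b' w -> X b w = X b' w.
Proof.
move=> Xpa bw; have kE i := knows_from_parents (i := i) Xpa bw.
case: (eqVneq w A) => [wA|wA].
  rewrite wA !backdoor_modelA; congr level; apply: eq_parity => i /(allP sA_A).
  by rewrite -wA; apply: kE.
case: (eqVneq w Y) => [wY|wY].
  move: kE bw; rewrite wY !backdoor_modelY => kE ->.
  rewrite (_ : parity sY b = parity sY b') //.
  by apply: eq_parity => i /(allP sY_Y); apply: kE.
rewrite /X (negbTE wA) (negbTE wY); congr ((choice.pickle _)%:R); congr (_, _).
  by apply/ffunP => i; rewrite !ffunE; case wi: (knows w i) => //=; apply: kE.
by rewrite bw.
Qed.

Lemma knows_ancestor w i : knows w i -> connect e i.1 w && connect e i.2 w.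
Proof.
move=> /knowsP[x /backdoor_connect_sub xw /andP[/andP[xi1 _] /andP[xi2 _]]].
have heard v : (v == x) || G v x -> connect e v w.
  move=> /orP[/eqP ->//|/backdoor_graph_sub vx].
  exact: connect_trans (connect1 vx) xw.
by rewrite !heard.
Qed.

Lemma flip_knows u w i b : ~~ connect e u w -> knows w i ->
  flip u b i.1 (+) flip u b i.2 = b i.1 (+) b i.2.
Proof.
move=> uw /knows_ancestor/andP[i1w i2w].
by rewrite !flip_neq //; [apply: contraNneq uw => <-|apply: contraNneq uw => <-].
Qed.

Lemma flip_parity u w s (b : bits) : ~~ connect e u w -> all (knows w) s ->
  parity s (flip u b) = parity s b.
Proof. by move=> uw /allP sw; apply: eq_parity => i /sw; apply: flip_knows. Qed.

Lemma backdoor_model_nd w u b : u \in nd e [set w] -> X (flip w b) u = X b u.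
Proof.
rewrite nd1E => wu; have uw : u != w by apply: contraNneq wu => ->.
rewrite /X; case: eqP => [uA|_].
  by congr level; apply: flip_parity sA_A; rewrite -uA.
case: eqP => [uY|_].
  rewrite flip_neq -?uY // (_ : parity _ (flip _ _) = parity sY b) //.
  by apply: flip_parity sY_Y; rewrite -uY.
congr ((choice.pickle _)%:R); congr (_, _); last by rewrite flip_neq.
by apply/ffunP => i; rewrite [LHS]ffunE [RHS]ffunE;
  case ui: (knows u i) => //=; apply: flip_knows ui.
Qed.

(** As [A] has no children, its bit is heard by [A] alone. *)
Lemma knows_A t i : knows t i -> t != A -> (i.1 != A) && (i.2 != A).
Proof.
move=> /knowsP[x xt /andP[/andP[xi1 _] /andP[xi2 _]]] tA.
have heard v : (v == x) || G v x -> v != A.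
  move=> /orP[/eqP ->|vx]; last by have /andP[] := parent_not_sink vx.
  apply: contraNneq tA => xA; rewrite xA in xt.
  by rewrite (sink_connect _ xt) // => ?; rewrite backdoor_sinkA.
by rewrite !heard.
Qed.

Lemma flipA_knows t i b : t != A -> knows t i ->
  flip A b i.1 (+) flip A b i.2 = b i.1 (+) b i.2.
Proof. by move=> tA ti; have /andP[i1 i2] := knows_A ti tA; rewrite !flip_neq. Qed.

Lemma flipA_parityY b : parity sY (flip A b) = parity sY b.
Proof.
by apply: eq_parity => i /(allP sY_Y); apply: flipA_knows; rewrite eq_sym.
Qed.

Lemma flipA_parityL b : parity sL (flip A b) = parity sL b.
Proof.
apply: eq_parity => i /(allP sL_L)/existsP[l /andP[/L_neqA lA]].
exact: flipA_knows.
Qed.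

(** By [parityE], since the two other sums ignore the bit of [A]. *)
Lemma flipA_parityA b : parity sA (flip A b) = ~~ parity sA b.
Proof.
have := parityE (flip A b); have := parityE b.
rewrite flipA_parityY flipA_parityL flip_at flip_neq 1?eq_sym //.
by case: (parity sA _); case: (parity sA _); case: (parity sY _);
  case: (parity sL _); case: (b A); case: (b Y).
Qed.

Lemma flipA_model b u : u != A -> X (flip A b) u = X b u.
Proof.
move=> uA; rewrite /X (negbTE uA); case: eqP => [uY|_].
  by rewrite flipA_parityY flip_neq // -uY.
congr ((choice.pickle _)%:R); congr (_, _); last by rewrite flip_neq.
by apply/ffunP => i; rewrite [LHS]ffunE [RHS]ffunE;
  case ui: (knows u i) => //=; apply: flipA_knows ui.
Qed.

Lemma complement_parity s (b : bits) : parity s (complement b) = parity s b.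
Proof. by apply: eq_parity => i _; apply: complement_diff. Qed.

(** Differences of bits are invariant when all bits change, and the vertices of
    [Z] reveal nothing else. *)
Lemma complement_model b : agree (A |: Z) (X (complement b)) (X b).
Proof.
apply/agreeP => u /setU1P[->|uZ]; first by rewrite !backdoor_modelA complement_parity.
have uA : u != A by apply: contraNneq A_Z => <-.
have uY : u != Y by apply: contraNneq Y_Z => <-.
rewrite /X (negbTE uA) (negbTE uY) /knowledge uZ /=; congr ((choice.pickle _)%:R).
by congr (_, _); apply/ffunP => i; rewrite [LHS]ffunE [RHS]ffunE complement_diff.
Qed.

Lemma parityL_agree (b b' : bits) :
  agree L (X b) (X b') -> parity sL b = parity sL b'.
Proof.
move=> /agreeP bb'; apply: eq_parity => i /(allP sL_L)/existsP[l /andP[lL li]].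
by have [-> //] := backdoor_model_reads (L_neqA lL) (L_neqY lL) (bb' l lL).
Qed.

(** Given its parents, [A] is the sum of its own bit and of a constant. *)
Lemma parityA_agree_pa b b' : agree (pa e A :|: L) (X b) (X b') ->
  parity sA b' = (b A (+) b' A) (+) parity sA b.
Proof.
have eqA b1 : agree (pa e A :|: L) (X b) (X b1) -> b A = b1 A ->
    parity sA b = parity sA b1.
  move=> /agreeP bb1 bA; apply: level_inj; rewrite -!backdoor_modelA.
  by apply: backdoor_model_structural bA => u uA; apply: bb1; rewrite !finset.inE uA.
move=> bb'; case: (eqVneq (b A) (b' A)) => [bA|bA].
  by rewrite -(eqA b') // bA addbb.
have -> : b A (+) b' A = true by case: (b A) (b' A) bA => -[].
rewrite (eqA (flip A b')); last by rewrite flip_at; case: (b A) (b' A) bA => -[].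
  by rewrite flipA_parityA addTb negbK.
rewrite (agree_trans _ bb'); apply/agreeP => u; rewrite !finset.inE => uA.
rewrite flipA_model //; case/orP: uA => [uA|/L_neqA //].
by apply/eqP => uE; case: (edge_connectF e_acyclic uA); rewrite uE.
Qed.

Lemma model_overlap (D : {set V}) : A \notin D ->
  overlap X A a0 a1 (parity sL) D.
Proof.
move=> AD b; case: (eqVneq (parity sA b) (parity sL b)) => bAL.
  by exists b; rewrite ?agree_refl // backdoor_modelA bAL.
exists (flip A b).
  by apply/agreeP => u uD; rewrite flipA_model //; apply: contraNneq AD => <-.
rewrite backdoor_modelA flipA_parityA; have -> // : ~~ parity sA b = parity sL b.
by case: (parity sA b) (parity sL b) bAL => -[].
Qed.

Local Notation mu := (bits_weight (coin R A)).

Let outcome b : R := (X b Y <= 1 / 2)%R%:R.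

Lemma outcomeE b : outcome b = (~~ (parity sY b (+) b Y))%:R.
Proof.
rewrite /outcome backdoor_modelY; case: (_ (+) _) => /=.
  by rewrite (_ : (_ <= _) = false) //; apply/negbTE; rewrite -ltNge; lra.
by rewrite (_ : (_ <= _) = true) //; lra.
Qed.

Lemma outcome_flipA b : outcome (flip A b) = outcome b.
Proof. by rewrite !outcomeE flipA_parityY flip_neq // eq_sym. Qed.

(** Changing all bits except that of [A] preserves the weights and the sum
    assigned to [Y], and it changes the bit of [Y]. *)
Lemma outcome_balanced : \sum_b mu b * outcome b = 1 / 2.
Proof.
under eq_bigr do rewrite outcomeE.
apply: (@coin_balanced _ _ _ (fun b => flip A (complement b))
  (fun b => ~~ (parity sY b (+) b Y))).
- by move=> b b' /(inv_inj (flipK A)) /(inv_inj (@complementK _)).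
- by move=> b; rewrite flip_at ffunE negbK.
- move=> b; rewrite flipA_parityY complement_parity flip_neq 1?eq_sym //.
  by rewrite ffunE addbN.
Qed.

Lemma A_notin_pa : A \notin pa e A :|: L.
Proof.
rewrite !finset.inE negb_or; apply/andP; split; last first.
  by apply/negP => /L_neqA; rewrite eqxx.
by apply/negP => AA; case: (edge_connectF e_acyclic AA).
Qed.

(** [A] has no effect on [Y]: given its parents and [L], the level of [A] is
    equivalent to the value of its own bit, of which the outcome is
    independent. *)
Lemma cond_mean_parents b t :
  cond_mean mu X (A |: (pa e A :|: L)) outcome (set_coord A (level t) (X b)) =
  cond_mean mu X (pa e A :|: L) outcome (X b).
Proof.
set W := pa e A :|: L.
(* the value of the own bit of A that gives it the level t when its parents
   have the values that they have under b *)
pose s := t (+) parity sA b (+) b A.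
pose G' b' : R := (agree W (X b) (X b'))%:R.
have G'A b' : G' (flip A b') = G' b'.
  congr (_%:R); congr (nat_of_bool _).
  rewrite agree_sym [RHS]agree_sym; apply: agree_trans; apply/agreeP => u uW.
  rewrite flipA_model //; apply/eqP => uA; case/negP: A_notin_pa.
  by rewrite -{1}uA.
have agE b' : agree (A |: W) (set_coord A (level t) (X b)) (X b') =
    agree W (X b) (X b') && (b' A == s).
  rewrite set_coord_agree ?A_notin_pa // andbC.
  case bb': (agree W _ _) => //=.
  rewrite backdoor_modelA (parityA_agree_pa bb') (inj_eq level_inj) /s.
  by case: (t); case: (parity sA b); case: (b A); case: (b' A).
have sumE (F : bits -> R) : (forall b', F (flip A b') = F b') ->
    \sum_(b' | agree (A |: W) (set_coord A (level t) (X b)) (X b')) mu b' * F b' =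
    coin R A A s * \sum_(b' | agree W (X b) (X b')) mu b' * F b'.
  move=> FA; rewrite (eq_bigl _ _ agE) big_mkcond /=.
  have := bit_independent (@coin_sum1 R V A) (w := A) (fun u => (u == s)%:R)
    (G := fun b' => G' b' * F b').
  rewrite (_ : \sum_u coin R A A u * (u == s)%:R = coin R A A s); last first.
    by rewrite big_bool /=; case: (s); rewrite /= mulr1 mulr0 ?addr0 ?add0r.
  move=> H; rewrite [in RHS](_ : \sum_(_ | _) _ =
      \sum_b' mu b' * (G' b' * F b')); last first.
    rewrite big_mkcond; apply: eq_bigr => b' _; rewrite /G'.
    by case: (agree _ _ _); rewrite ?(mul1r, mul0r, mulr0).
  rewrite -H => [|b']; last by rewrite G'A FA.
  apply: eq_bigr => b' _; rewrite /G'.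
  by case: (agree _ _ _); case: eqP; rewrite ?(mul1r, mul0r, mulr0).
rewrite /cond_mean (sumE _ outcome_flipA); have := sumE (fun=> 1) (fun=> erefl).
under eq_bigr do rewrite mulr1; under [X in _ * X]eq_bigr do rewrite mulr1.
move=> ->; have cancel_coef (k n d : R) : k != 0 -> k * n / (k * d) = n / d.
  by move=> k0; rewrite invfM mulrACA mulfV ?mul1r.
by rewrite cancel_coef // gt_eqF // coin_gt0.
Qed.

(** On the event that [A] takes the chosen level and [Z] the values that it has
    under [b], the outcome is the indicator that the bit of [A] vanishes, and
    changing all bits maps the part of this event where the bit of [A] is 1 onto
    the part where it is 0, multiplying the weights by 3. *)
Lemma cond_mean_separated b :
  cond_mean mu X (A |: Z) outcome (set_coord A (level (parity sL b)) (X b)) =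
  3 / 4.
Proof.
have mu_gt0 : forall b, 0 < mu b by apply: bits_weight_gt0; apply: coin_gt0.
pose T (b' : bits) :=
  agree (A |: Z) (set_coord A (level (parity sL b)) (X b)) (X b').
have TE b' : T b' = (X b' A == level (parity sL b)) && agree Z (X b) (X b').
  by rewrite /T set_coord_agree.
have outcomeT b' : T b' -> outcome b' = (~~ b' A)%:R.
  rewrite TE backdoor_modelA (inj_eq level_inj) outcomeE.
  move=> /andP[/eqP bA /agreeP bb'].
  have bL : parity sL b = parity sL b'.
    by apply: parityL_agree; apply/agreeP => l /(fintype.subsetP L_Z)/bb'.
  have := parityE b'; rewrite bA bL.
  by case: (parity sY b'); case: (parity sL b'); case: (b' A); case: (b' Y).
transitivity ((\sum_(b' | T b') mu b' * (~~ b' A)%:R) / \sum_(b' | T b') mu b').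
  by congr (_ / _); apply: eq_bigr => b' /outcomeT <-.
pose S t := \sum_(b' : bits | T b' && (b' A == t)) mu b'.
have SE : \sum_(b' | T b') mu b' = S true + S false.
  rewrite (bigID (fun b' : bits => b' A)) /=.
  by congr (_ + _); apply: eq_bigl => b'; rewrite ?eqb_id ?eqbF_neg.
have S3 : S false = 3 * S true.
  rewrite /S (reindex_inj (inv_inj (@complementK _))) mulr_sumr /=.
  rewrite (eq_bigl (fun b' : bits => T b' && (b' A == true))) => [|b'].
    by apply: eq_bigr => b' /andP[_ /eqP b'A]; rewrite coin_weight_complement.
  rewrite ffunE eqbF_neg negbK eqb_id !TE; congr (_ && _).
  have /agreeP cb := complement_model b'; rewrite cb ?finset.setU11 //.
  congr (_ && _); rewrite agree_sym [RHS]agree_sym; apply: agree_trans.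
  by apply/agreeP => u uZ; rewrite cb // finset.setU1r.
have S_gt0 : 0 < S true + S false.
  have [b' bb' b'A] := model_overlap A_Z b.
  rewrite -SE (bigD1 b') /=; last by rewrite TE b'A eqxx.
  by rewrite ltr_pwDl // sumr_ge0 // => b'' _; apply: ltW.
have -> : \sum_(b' | T b') mu b' * (~~ b' A)%:R = S false.
  rewrite /S big_mkcondr; apply: eq_bigr => b' _; rewrite eqbF_neg.
  by case: (b' A); rewrite ?(mulr0, mulr1).
rewrite SE S3; field.
by apply/eqP => S0; move: S_gt0; rewrite S3; lra.
Qed.

Lemma backdoor_model_not_adjusted (TA : {fset R}) (N : {set V}) :
  a0 \in TA -> a1 \in TA -> ~ adjustment_set e A Y TA L N Z.
Proof.
move=> a0_TA a1_TA adj.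
have mu_gt0 : forall b, 0 < mu b by apply: bits_weight_gt0; apply: coin_gt0.
have mu_sum1 : \sum_b mu b = 1 by apply: bits_weight_sum1; apply: coin_sum1.
have [P P_law] := discrete_law_exists (X : _ -> sample R V)
  (fun b => ltW (mu_gt0 b)) mu_sum1.
have X_A b : exists t, X b A = level t.
  by exists (parity sA b); rewrite backdoor_modelA.
have := adjustment_set_model_eq (@coin_gt0 R V A) (@coin_sum1 R V A) e_acyclic
  backdoor_model_structural backdoor_model_nd (1 / 2) a0_TA a1_TA a1_neq0 X_A
  parityL_agree P_law adj (model_overlap A_notin_pa) (model_overlap A_Z).
under eq_bigr do rewrite cond_mean_parents.
rewrite (@cond_mean_total _ _ _ _ _ mu_gt0 _ outcome xpredT) // outcome_balanced.
under eq_bigr do rewrite cond_mean_separated.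
by rewrite -mulr_suml mu_sum1; lra.
Qed.

End BackdoorModel.

(** Otherwise the walk carries a structural model in which the two sides of the
    adjustment formula are 1/2 and 3/4. *)
Lemma adjustment_set_blocks (R : realType) (V : finType) (e : rel V)
    (A Y : V) (TA : {fset R}) (L N Z : {set V}) (a0 a1 : R) (q : seq V) :
  acyclic e -> connect e A Y -> A != Y -> L \subset nd e [set A] ->
  a0 \in TA -> a1 \in TA -> a1 != a0 ->
  adjustment_set e A Y TA L N Z ->
  path (H0 e A Y L) A (rcons q Y) -> exists2 v, v \in q & v \in Z.
Proof.
move=> e_acyclic AY A_neq_Y L_nd a0_TA a1_TA a1_neq0 adj Aq.
have [ZAY L_Z _ _] := adj.
have AZ : A \notin Z.
  by apply/negP => /(fintype.subsetP ZAY); rewrite !finset.inE eqxx.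
have YZ : Y \notin Z.
  by apply/negP => /(fintype.subsetP ZAY); rewrite !finset.inE eqxx orbT.
apply: contrapT => nZ.
have [|sA [sY [sL [kA kY kL]]]] := walk_parities (Z := Z) Aq.
  move=> v; rewrite in_cons mem_rcons in_cons => /or3P[/eqP->//|/eqP->//|vq].
  by apply/negP => vZ; apply: nZ; exists v.
rewrite last_rcons => sE.
exact: (backdoor_model_not_adjusted e_acyclic AY A_neq_Y L_nd AZ YZ L_Z
  a1_neq0 kA kY kL sE a0_TA a1_TA adj).
Qed.

(** * Separators and cuts *)

Section Flow.
Variables (R : realType) (V : finType) (e : rel V) (A Y : V) (L N : {set V}).
Variable c : V -> R.
Hypotheses (A_neq_Y : A != Y) (AYL_N : [set A; Y] :|: L \subset N).
Hypothesis c_gt0 : forall w, w \in N -> 0 < c w.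

Local Notation H1v := (H1_vertices e A Y L N).
Local Notation H := (H1 e A Y L N).
Local Notation E := (D e A Y L N).
Local Notation src := (source Y).
Local Notation sep := (separator e A Y L N).

Lemma moral_sym (T : finType) (g : rel T) : symmetric (moral g).
Proof.
move=> u w; rewrite /moral eq_sym; congr (_ && _).
rewrite orbCA; do 2!congr (_ || _).
by apply: eq_existsb => x; rewrite andbC.
Qed.

Lemma H1_sym : symmetric H.
Proof.
suff imp u w : H u w -> H w u by move=> u w; apply/idP/idP; apply: imp.
move=> /and4P[uH wH uw adj]; rewrite /H1 wH uH eq_sym uw /=.
case/or3P: adj => [/asboolP[p pH pI]|->|->]; rewrite ?orbT //.
apply/orP; left; apply/asboolP; exists (rev p).
  rewrite -rev_cons -(belast_rcons u p w) -[X in path _ X _](last_rcons u p w).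
  by rewrite rev_path (eq_path (e' := H0 e A Y L)) // => x y; exact: (@moral_sym V).
by move=> x; rewrite mem_rev => /pI.
Qed.

Lemma H1_verticesN w : w \in H1v -> w \in N.
Proof.
rewrite !finset.inE; case wAY: ((w == A) || (w == Y)) => /=.
  by move=> _; apply: (fintype.subsetP AYL_N); rewrite !finset.inE wAY.
by move=> /andP[+ anw]; rewrite anw /= negb_or negbK => /andP[].
Qed.

Lemma Y_H1 : Y \in H1v.
Proof.
rewrite !finset.inE eqxx orbT /=; apply/existsP; exists Y.
by rewrite !finset.inE eqxx orbT connect0.
Qed.

Lemma H1_edge_vertices u w : H u w -> (u \in H1v) && (w \in H1v).
Proof. by case/and4P => -> ->. Qed.

Definition avoid (Z : {set V}) : rel V :=
  fun u w => [&& H u w, u \notin Z & w \notin Z].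

Lemma avoid_sym Z : symmetric (avoid Z).
Proof. by move=> u w; rewrite /avoid H1_sym; congr (_ && _); rewrite andbC. Qed.

(** Separation as unreachability, which is how cuts are compared with
    separators. *)
Lemma separatorP Z :
  sep Z <-> [/\ Z \subset H1v, [disjoint Z & [set A; Y]] &
                ~~ connect (avoid Z) Y A].
Proof.
rewrite (sym_connect_sym (avoid_sym Z)).
split=> -[ZH ZAY sepZ]; split=> //.
  apply/negP => /connectP[p Ap pY].
  have /sepZ[w wp wZ] : dipath H A p Y.
    by rewrite /dipath -pY eqxx andbT; apply: sub_path Ap => ? ? /and3P[].
  have nZ : all (fun v => v \notin Z) p.
    move: (A) Ap => a ap; elim: p a ap {pY wp} => //= x p IH a.
    by move=> /andP[/and3P[_ _ ->] /IH].
  move: wp; rewrite in_cons => /orP[/eqP wA|/(allP nZ)]; last by rewrite wZ.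
  by move/pred0P/(_ A): ZAY; rewrite /= -wA wZ !finset.inE wA eqxx.
move=> p /andP[Ap /eqP pY]; apply: contrapT => nZ; case/negP: sepZ.
apply/connectP; exists p => //.
have {}nZ w : w \in A :: p -> w \notin Z.
  by move=> wp; apply/negP => wZ; apply: nZ; exists w.
have sub a q : path H a q -> (forall w, w \in a :: q -> w \notin Z) ->
    path (avoid Z) a q.
  elim: q a => //= x q IH a /andP[ax xq] aqZ.
  rewrite /avoid ax !aqZ ?in_cons ?eqxx ?orbT // IH // => w wq.
  by apply: aqZ; rewrite in_cons wq orbT.
exact: sub.
Qed.

Lemma separator_notAY Z w : sep Z -> w \in Z -> w \notin [set A; Y].
Proof. by case=> _ /disjointFr H _ wZ; rewrite H. Qed.

Lemma separator_notA Z : sep Z -> A \notin Z.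
Proof. by move=> /separator_notAY nZ; apply/negP => /nZ; rewrite !finset.inE eqxx. Qed.

Lemma separator_notY Z : sep Z -> Y \notin Z.
Proof.
by move=> /separator_notAY nZ; apply/negP => /nZ; rewrite !finset.inE eqxx orbT.
Qed.

(** All remaining vertices form a separator unless [A] and [Y] are adjacent. *)
Lemma separator_not_adjacent : ~~ H A Y -> sep (H1v :\: [set A; Y]).
Proof.
move=> nAY; split=> [||p /andP[Ap /eqP pY]].
- exact: finset.subsetDl.
- rewrite disjoint_subset; apply/fintype.subsetP => w.
  by rewrite finset.in_setD => /andP[].
- case: p Ap pY => [_ /= AYE|x p /= /andP[Ax _] _].
    by move: A_neq_Y; rewrite AYE eqxx.
  exists x; first by rewrite !in_cons eqxx orbT.
  have /andP[_ xH] := H1_edge_vertices Ax.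
  rewrite finset.in_setD xH andbT !finset.inE negb_or; apply/andP; split.
    by case/and4P: Ax => _ _; rewrite eq_sym.
  by apply: contraNneq nAY => xY; rewrite -{2}xY.
Qed.

Lemma cost_subset (W Z : {set V}) : W \subset Z -> Z \subset H1v ->
  cost c W <= cost c Z ?= iff (W == Z).
Proof.
move=> WZ ZH; have pos w : w \in Z -> 0 < c w.
  by move=> /(fintype.subsetP ZH)/H1_verticesN; apply: c_gt0.
have -> : cost c Z = cost c W + \sum_(w in Z :\: W) c w.
  by rewrite /cost (finset.big_setID W) /= (finset.setIidPr WZ).
split.
  by rewrite lerDl sumr_ge0 // => w /finset.setDP[/pos/ltW].
rewrite eq_sym -subr_eq0 addrAC subrr add0r.
apply/idP/eqP => [/eqP|->]; last by rewrite finset.setDv big_set0.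
move=> sum0; apply/eqP; rewrite finset.eqEsubset WZ /=; apply/fintype.subsetP => w wZ.
apply/negPn/negP => wW; have : 0 < \sum_(v in Z :\: W) c v.
  rewrite (bigD1 w) /= ?finset.in_setD ?wW // ltr_pwDl ?pos //.
  by rewrite sumr_ge0 // => v /andP[/finset.setDP[/pos/ltW]].
by rewrite sum0 ltxx.
Qed.

Lemma min_cost_minimal Z :
  min_cost_separator e A Y L N c Z -> minimal_separator e A Y L N Z.
Proof.
move=> [sZ minZ]; split=> // W WZ sW.
have [ZH _ _] := sZ; have le := cost_subset (proper_sub WZ) ZH.
have := minZ W sW; rewrite (ge_leif le) => /eqP WE.
by rewrite WE fintype.properxx in WZ.
Qed.

Lemma D_edgeP x y : reflect
  ((exists2 w, w \in H1v & x = inn w /\ y = out w) \/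
   (exists u w, [/\ H u w, x = out u & y = inn w])) (E x y).
Proof.
apply: (iffP orP) => -[].
- by case/existsP=> w /and3P[wH /eqP-> /eqP->]; left; exists w.
- by case/existsP=> u /existsP[w /and3P[uw /eqP-> /eqP->]]; right; exists u, w.
- case=> w wH [-> ->]; left; apply/existsP; exists w; by rewrite wH !eqxx.
- case=> u [w [uw -> ->]]; right; apply/existsP; exists u; apply/existsP; exists w.
  by rewrite uw !eqxx.
Qed.

Lemma D_internal_edge w : w \in H1v -> E (inn w) (out w).
Proof. by move=> wH; apply/D_edgeP; left; exists w. Qed.

Lemma D_external_edge u w : H u w -> E (out u) (inn w).
Proof. by move=> uw; apply/D_edgeP; right; exists u, w. Qed.

Lemma D_into_out x w : E x (out w) -> x = inn w.
Proof. by case/D_edgeP => [[v _ [-> [->]]]|[u [v [_ _]]]]. Qed.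

Lemma D_from_inn w y : E (inn w) y -> y = out w.
Proof. by case/D_edgeP => [[v _ [[->] ->]]|[u [v [_]]]]. Qed.

Lemma D_target x y : E x y -> y.1 \in H1v.
Proof.
by case/D_edgeP => [[v vH [_ ->]]|[u [v [/H1_edge_vertices/andP[_ vH] _ ->]]]].
Qed.

Lemma capacity_internal w : w \in H1v -> w \notin [set A; Y] ->
  capacity e A Y L N c (inn w, out w) = (c w)%:E.
Proof.
move=> wH wAY; rewrite /capacity /= wAY andbT ifT //.
by apply/existsP; exists w; rewrite wH !eqxx.
Qed.

Lemma finite_capacity_internal x y :
  capacity e A Y L N c (x, y) != +oo%E ->
  exists2 w, w \notin [set A; Y] & x = inn w /\ y = out w.
Proof.
rewrite /capacity /=; case: ifP => // /andP[/existsP[w]].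
by move=> /and3P[wH /eqP-> /eqP->] /=; exists w.
Qed.

Lemma capacity_ge0 f : (0 <= capacity e A Y L N c f)%E.
Proof.
rewrite /capacity; case: ifP => // /andP[/existsP[w /and3P[wH /eqP-> _]] _].
by rewrite lee_fin ltW // c_gt0 // H1_verticesN.
Qed.

Local Notation hm := (hmap e A Y L N).
Local Notation cedges := (cut_edges e A Y L N).
Local Notation ccap := (cut_capacity e A Y L N c).

Lemma in_cut_edges S x y : ((x, y) \in cedges S) =
  [&& x \in S, y \notin S, y.1 \in H1v & E x y].
Proof.
rewrite finset.inE /= finset.in_setD [y \in D_vertices _ _ _ _ _]finset.inE.
by rewrite -andbA.
Qed.

(** When only internal edges of finite capacity leave [S], the cut edges
    correspond to the vertices of [hmap S]. *)
Lemma internal_cut_capacity S :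
  (forall f, f \in cedges S ->
     exists2 w, w \notin [set A; Y] & f = (inn w, out w)) ->
  ccap S = (cost c (hm S))%:E.
Proof.
move=> cutS.
have cutE : cedges S = [set (inn w, out w) | w in hm S].
  apply/finset.setP => f; apply/idP/imsetP => [fS|[w wS ->]].
    have [w _ fE] := cutS _ fS; exists w => //.
    by rewrite finset.inE -fE.
  by move: wS; rewrite finset.inE.
rewrite /cut_capacity cutE big_imset => [|u w _ _ [] //].
rewrite -sumEFin; apply: eq_bigr => w; rewrite finset.inE => wS.
have [v vAY [wv _]] := cutS _ wS; rewrite -wv in vAY.
rewrite capacity_internal //.
by move: wS; rewrite in_cut_edges => /and4P[].
Qed.

(** No external edge leaves a cut of finite capacity, so a walk of [H1] from [Y]
    that avoids [hmap S] never leaves [S], whereas the sink is outside of [S]. *)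
Lemma finite_cut_separator S : is_cut e A Y L N S -> (ccap S < +oo)%E ->
  sep (hm S) /\ (cost c (hm S))%:E = ccap S.
Proof.
move=> cutS finS.
have internal f : f \in cedges S ->
    exists2 w, w \notin [set A; Y] & f = (inn w, out w).
  move=> fS; have [|w wAY [f1 f2]] := @finite_capacity_internal f.1 f.2.
    rewrite -surjective_pairing; apply: contraTneq finS => fy.
    rewrite -leNgt /cut_capacity (bigD1 f) //= fy addye // gt_eqF //.
    apply: lt_le_trans (ltNye 0) _; apply: sume_ge0 => g _; exact: capacity_ge0.
  by exists w => //; rewrite [f]surjective_pairing f1 f2.
split; last by rewrite internal_cut_capacity.
have [SD srcS sinkS] := cutS.
apply/separatorP; split.
- by apply/fintype.subsetP => w; rewrite finset.inE in_cut_edges => /and4P[].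
- rewrite disjoint_subset; apply/fintype.subsetP => w; rewrite finset.inE.
  by move=> /internal[v vAY [-> _]].
- apply/negP => /connectP[p Yp pA].
  suff: (A == Y) || (inn A \in S).
    by rewrite (negbTE A_neq_Y) (negbTE sinkS).
  have step : forall q u, out u \in S -> (u == Y) || (inn u \in S) ->
      path (avoid (hm S)) u q ->
      (last u q == Y) || (inn (last u q) \in S).
    elim=> //= w q IH u uS _ /andP[/and3P[uw _ wh] wq].
    have /andP[_ wH] := H1_edge_vertices uw.
    have wS : inn w \in S.
      apply/negPn/negP => wS; have [|v _ []//] := internal (out u, inn w).
      by rewrite in_cut_edges uS wS wH D_external_edge.
    apply: IH => //; last by rewrite wS orbT.
    apply: contraNT wh => w'S.
    by rewrite finset.inE in_cut_edges wS w'S wH D_internal_edge.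
  by rewrite pA; apply: step Yp => //; rewrite eqxx.
Qed.

(** The edges of [D] that can be followed before [Z] is left: a walk may enter
    [w'] for [w] in [Z], but it has to stop there. *)
Definition reach_to (Z : {set V}) : rel (V * bool) :=
  fun x y => E x y && (x.1 \notin Z).

Lemma reach_out (Z : {set V}) w :
  Y \notin Z -> connect (reach_to Z) src (out w) -> w \notin Z.
Proof.
move=> YZ /connectP[p]; case/lastP: p => [_ [->] //|p x].
by rewrite rcons_path last_rcons => /andP[_ /andP[+ xZ]] xE;
  rewrite -xE => /D_into_out pE; rewrite pE in xZ.
Qed.

Lemma reach_avoid (Z : {set V}) x : Y \notin Z -> connect (reach_to Z) src x ->
  x.1 \notin Z -> connect (avoid Z) Y x.1.
Proof.
move=> YZ /connectP[p + ->]; elim/last_ind: p => [_ _ /=|p y IH].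
  exact: connect0.
rewrite rcons_path last_rcons => /andP[srcp /andP[py pZ]] yZ.
apply: connect_trans (IH srcp pZ) _.
case/D_edgeP: py => [[w _ [-> ->]]|[u [w [uw pE yE]]]]; first exact: connect0.
apply: connect1; rewrite pE yE /= /avoid uw.
by rewrite pE in pZ; rewrite yE in yZ; rewrite pZ.
Qed.

Lemma reach_vertices (Z : {set V}) x :
  connect (reach_to Z) src x -> x.1 \in H1v.
Proof.
move=> /connectP[p + ->]; case/lastP: p => [_|p y]; first exact: Y_H1.
by rewrite rcons_path last_rcons => /andP[_ /andP[/D_target]].
Qed.

(** The cut consists of what is reachable from the source without crossing [Z].
    Unlike [dmap Z] it is available for all separators, minimal or not, and
    also for the empty one. *)
Lemma separator_cut_le Z : sep Z ->
  exists2 S, is_cut e A Y L N S & (ccap S <= (cost c Z)%:E)%E.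
Proof.
move=> sZ; have [ZH ZAY nYA] := (separatorP Z).1 sZ.
have nZ := separator_notAY sZ; have YZ := separator_notY sZ.
have AZ := separator_notA sZ.
pose S := [set x | connect (reach_to Z) src x].
have inS x : (x \in S) = connect (reach_to Z) src x by rewrite finset.inE.
have edges f : f \in cedges S -> exists2 w, w \in Z & f = (inn w, out w).
  case: f => x y; rewrite in_cut_edges !inS => /and4P[sx sy _ xy].
  have xZ : x.1 \in Z.
    apply: contraNT sy => xZ; apply: connect_trans sx (connect1 _).
    by rewrite /reach_to xy.
  case/D_edgeP: xy => [[w _ [xE yE]]|[u [w [_ xE _]]]]; rewrite xE /= in xZ.
    by exists w; rewrite ?xE ?yE.
  by have := reach_out YZ (w := u); rewrite -xE xZ; move/(_ sx).
exists S.
  split; rewrite ?inS ?connect0 //.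
    apply/fintype.subsetP => x; rewrite inS => /reach_vertices.
    by rewrite [x \in D_vertices _ _ _ _ _]finset.inE.
  by apply: contraNN nYA => /(reach_avoid YZ); apply.
rewrite internal_cut_capacity; last first.
  by move=> f /edges[w wZ ->]; exists w; rewrite ?nZ.
rewrite lee_fin cost_subset //.
by apply/fintype.subsetP => w; rewrite finset.inE => /edges[v vZ [-> _]].
Qed.

Local Notation dm := (dmap e A Y L N).

(** The condition that the walk meets [Z] only at its end becomes a condition on
    edges: a walk that has entered [w'] with [w] in [Z] could only go on to [w''],
    which is excluded. *)
Lemma dmapP (Z : {set V}) x : reflect
  (x = src \/ exists2 w, w \in Z &
     connect (reach_to Z) src x && connect (reach_to Z) x (inn w))
  (x \in dm Z).
Proof.
have pathP p y w : w \in Z -> path E y p -> last y p = inn w ->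
    (forall z, z \in y :: p -> z.1 \in Z -> z = inn w) -> path (reach_to Z) y p.
  move=> wZ; elim: p y => //= z p IH y /andP[yz zp] pE nZ.
  rewrite IH // => [|v vp]; last by apply: nZ; rewrite in_cons vp orbT.
  rewrite /reach_to yz /= andbT; apply/negP => yZ.
  have yw : y = inn w by apply: nZ yZ; rewrite mem_head.
  rewrite yw in yz; have zE := D_from_inn yz.
  by have := nZ z; rewrite zE !in_cons eqxx orbT /= => /(_ isT wZ).
apply: (iffP idP); rewrite in_setU1 finset.inE.
  case/orP => [/eqP|/asboolP[w [p [wZ /andP[srcp /eqP pw] nZ xp]]]]; first by left.
  right; exists w => //; have {}srcp := pathP _ _ _ wZ srcp pw nZ.
  case/splitPl: xp srcp pw => p1 p2 xE.
  rewrite cat_path last_cat xE => /andP[srcp1 xp2] p2w.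
  by apply/andP; split; apply/connectP; [exists p1|exists p2].
case=> [->|[w wZ /andP[/connectP[p1 srcp1 xE] /connectP[p2 xp2 wE]]]].
  by rewrite eqxx.
apply/orP; right; apply/asboolP; exists w, (p1 ++ p2).
have srcp : path (reach_to Z) src (p1 ++ p2) by rewrite cat_path srcp1 -xE.
have pw : last src (p1 ++ p2) = inn w by rewrite last_cat -xE.
split=> //.
- rewrite /dipath pw eqxx andbT.
  by apply: sub_path srcp => ? ? /andP[].
- elim: (p1 ++ p2) src srcp pw => /= [y _ -> z|z p IH y /andP[/andP[_ yZ] zp] pw v].
    by rewrite inE => /eqP.
  rewrite in_cons => /orP[/eqP->|]; first by rewrite (negbTE yZ).
  exact: IH.
- by rewrite -cat_cons mem_cat xE mem_last.
Qed.

(** By minimality some walk of [H1] from [Y] to [A] meets [Z] only in [w]. *)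
Lemma minimal_reached (Z : {set V}) w :
  minimal_separator e A Y L N Z -> w \in Z ->
  connect (reach_to Z) src (inn w).
Proof.
move=> [sZ minZ] wZ; have [ZH ZAY nYA] := (separatorP Z).1 sZ.
have YZ := separator_notY sZ.
apply: contrapT => nw; have := minZ (Z :\ w) (properD1 wZ); apply.
apply/separatorP; split.
- exact: fintype.subset_trans (subD1set _ _) ZH.
- by apply: disjointWl ZAY; apply: subD1set.
- apply/negP => /connectP[p Yp pA]; case/negP: nYA; rewrite pA.
  have step : forall q u, connect (reach_to Z) src (out u) ->
      path (avoid (Z :\ w)) u q -> connect (reach_to Z) src (out (last u q)).
    elim=> //= v q IH u su /andP[/and3P[uv _ vZw] vq]; apply: IH vq.
    have uZ := reach_out YZ su.
    have sv : connect (reach_to Z) src (inn v).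
      apply: connect_trans su (connect1 _).
      by rewrite /reach_to D_external_edge.
    have vZ : v \notin Z.
      move: vZw; rewrite finset.in_setD1 negb_and negbK => /orP[/eqP vw|//].
      by case: nw; rewrite -vw.
    apply: connect_trans sv (connect1 _).
    have /andP[_ vH] := H1_edge_vertices uv.
    by rewrite /reach_to D_internal_edge.
  have sA := step p Y (connect0 _ _) Yp.
  by apply: (reach_avoid YZ sA); apply: reach_out sA.
Qed.

(** Let an edge of [D] start outside of [Z] on a walk that leads from the source
    to [Z].  If it is internal it is the next edge of the walk; if it is
    external, from [u''] to [v'], then [v] is in [Z] or one can return through
    [v''], [u'] and [u''], as [H1] is symmetric.  So its end lies in [dmap Z]. *)
Lemma dmap_cut_edges Z : Z != finset.set0 -> minimal_separator e A Y L N Z ->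
  cedges (dm Z) = [set (inn w, out w) | w in Z].
Proof.
move=> /finset.set0Pn[w0 w0Z] minZ; have [sZ _] := minZ.
have [ZH _ _] := sZ; have YZ := separator_notY sZ.
have src_w0 := minimal_reached minZ w0Z.
have dmE x : (x \in dm Z) <-> exists2 w, w \in Z &
     connect (reach_to Z) src x && connect (reach_to Z) x (inn w).
  split=> [/dmapP[->|//]|xZ]; last by apply/dmapP; right.
  by exists w0; rewrite ?connect0.
apply/finset.setP => -[x y]; apply/idP/imsetP => [|[w wZ [-> ->]]]; last first.
  have wH := fintype.subsetP ZH w wZ.
  rewrite in_cut_edges wH D_internal_edge // !andbT; apply/andP; split.
    by apply/dmE; exists w; rewrite ?connect0 ?minimal_reached.
  by apply/negP => /dmE[v _ /andP[/(reach_out YZ)]]; rewrite wZ.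
rewrite in_cut_edges => /and4P[/dmE[w wZ /andP[sx xw]] ySn _ xy].
have to_y : x.1 \notin Z -> connect (reach_to Z) src y.
  move=> xZ; apply: connect_trans sx (connect1 _).
  by rewrite /reach_to xy.
case/D_edgeP: (xy) => [[u uH [xE yE]]|[u [v [uv xE yE]]]].
  case uZ: (u \in Z); first by exists u; rewrite ?xE ?yE.
  case/negP: ySn; apply/dmE; exists w => //; rewrite to_y ?xE ?uZ //=.
  move/connectP: xw => [[|z p] /=]; rewrite xE.
    by move=> _ [wu]; rewrite -wu wZ in uZ.
  move=> /andP[/andP[/D_from_inn zE _] zp] wE; rewrite yE -zE.
  by apply/connectP; exists p.
have uZ : u \notin Z by apply: (reach_out YZ); rewrite -xE.
case/negP: ySn; apply/dmE; case vZ: (v \in Z).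
  by exists v; rewrite ?to_y ?xE // yE connect0.
exists w => //; rewrite to_y ?xE //=; apply: connect_trans xw.
have /andP[uH vH] := H1_edge_vertices uv.
rewrite yE xE; apply: (@connect_trans _ _ (out v)).
  by apply: connect1; rewrite /reach_to D_internal_edge // vZ.
apply: (@connect_trans _ _ (inn u)); apply: connect1.
  by rewrite /reach_to D_external_edge ?vZ // H1_sym.
by rewrite /reach_to D_internal_edge.
Qed.

Lemma dmap_cut Z : minimal_separator e A Y L N Z -> is_cut e A Y L N (dm Z).
Proof.
move=> [sZ _]; have [_ _ nYA] := (separatorP Z).1 sZ.
have YZ := separator_notY sZ; have AZ := separator_notA sZ.
split.
- apply/fintype.subsetP => x /dmapP[->|[w _ /andP[/reach_vertices xH _]]].
    by rewrite finset.inE Y_H1.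
  by rewrite finset.inE.
- by apply/dmapP; left.
- apply: contraNN nYA => /dmapP[[]|[w _ /andP[sx _]]].
    by move/eqP; rewrite (negbTE A_neq_Y).
  exact: (reach_avoid YZ sx).
Qed.

Lemma hmap_dmap Z : minimal_separator e A Y L N Z -> hm (dm Z) = Z.
Proof.
move=> minZ; apply/finset.setP => w; rewrite finset.inE.
case: (eqVneq Z finset.set0) => [Z0|Z0]; last first.
  rewrite dmap_cut_edges //; apply/imsetP/idP => [[v vZ [->]]//|wZ].
  by exists w.
rewrite Z0 finset.in_set0 in_cut_edges; apply/negP => /andP[/dmapP[[]//|[v]]].
by rewrite finset.in_set0.
Qed.

Lemma dmap_cut_capacity Z : Z != finset.set0 -> minimal_separator e A Y L N Z ->
  ccap (dm Z) = (cost c Z)%:E.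
Proof.
move=> Z0 minZ; rewrite internal_cut_capacity ?hmap_dmap // => f.
rewrite dmap_cut_edges // => /imsetP[w wZ ->]; exists w => //.
by apply: separator_notAY wZ; case: minZ.
Qed.

Lemma min_cost_min_cut Z : Z != finset.set0 ->
  min_cost_separator e A Y L N c Z -> min_cut e A Y L N c (dm Z).
Proof.
move=> Z0 mcZ; have minZ := min_cost_minimal mcZ.
split=> [|S cutS]; first exact: dmap_cut.
rewrite dmap_cut_capacity //; have [finS|] := ltP (ccap S) +oo%E; last first.
  by move=> infS; apply: le_trans infS; rewrite leey.
have [sS <-] := finite_cut_separator cutS finS.
by rewrite lee_fin; apply: (proj2 mcZ).
Qed.

(** If [A] and [Y] are not adjacent, some separator bounds the capacity of a
    min-cut, which is therefore finite. *)
Lemma min_cut_min_cost S : ~~ H A Y ->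
  min_cut e A Y L N c S -> min_cost_separator e A Y L N c (hm S).
Proof.
move=> nAY [cutS minS].
have le_sep Z : sep Z -> (ccap S <= (cost c Z)%:E)%E.
  by move=> /separator_cut_le[T /minS]; apply: le_trans.
have finS : (ccap S < +oo)%E.
  by apply: le_lt_trans (le_sep _ (separator_not_adjacent nAY)) (ltry _).
have [sS capS] := finite_cut_separator cutS finS.
by split=> // Z /le_sep; rewrite -capS lee_fin.
Qed.

End Flow.

(** [L] contains neither [A] nor [Y], so an edge between them in [H1] comes from a
    walk of [H0] through vertices that do not belong to [Z]. *)
Lemma adjustment_set_not_adjacent (R : realType) (V : finType) (e : rel V)
    (A Y : V) (TA : {fset R}) (L N Z : {set V}) :
  acyclic e -> connect e A Y -> A != Y -> L \subset nd e [set A] ->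
  (1 < #|` TA|)%N -> adjustment_set e A Y TA L N Z -> ~~ H1 e A Y L N A Y.
Proof.
move=> e_acyclic AY A_neq_Y L_nd TA_gt1 adj.
have [a0 a0_TA] : exists a0, a0 \in TA.
  by apply/fset0Pn; rewrite -cardfs_gt0 ltnW.
have [a1 a1_TA] : exists a1, a1 \in (TA `\ a0)%fset.
  by apply/fset0Pn; move: TA_gt1; rewrite -cardfs_gt0 (cardfsD1 a0) a0_TA.
move: a1_TA; rewrite in_fsetD1 => /andP[a1_neq0 a1_TA].
have AL : A \notin L.
  by apply/negP => /(fintype.subsetP L_nd); rewrite nd1E connect0.
have YL : Y \notin L.
  by apply/negP => /(fintype.subsetP L_nd); rewrite nd1E AY.
apply/negP => /and4P[_ _ _]; rewrite (negbTE AL) (negbTE YL) !andbF !orbF.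
move=> /asboolP[q Aq q_ignore].
have [v vq vZ] := adjustment_set_blocks e_acyclic AY A_neq_Y L_nd a0_TA a1_TA
  a1_neq0 adj Aq.
have ZN : v \in N by have [_ _ /fintype.subsetP ZN _] := adj; apply: ZN.
have := adjustment_set_not_forb e_acyclic a0_TA a1_TA a1_neq0 L_nd adj.
move=> /disjointFr/(_ vZ) v_forb; have := q_ignore v vq.
by rewrite finset.in_setI finset.in_setU v_forb finset.in_setC ZN andbF.
Qed.

Theorem proposition1 (R : realType) (V : finType) (e : rel V) (A Y : V)
    (L N : {set V}) (c : V -> R) (TA : {fset R})
    (e_acyclic : acyclic e)
    (A_neq_Y : A != Y)
    (Y_de_A : Y \in de e [set A])
    (AYL_N : [set A; Y] :|: L \subset N)
    (L_nd_A : L \subset nd e [set A])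
    (c_gt0 : forall w, w \in N -> 0 < c w)
    (TA_gt1 : (1 < #|` TA |)%N)
    (adj : exists Z : {set V}, adjustment_set e A Y TA L N Z) :
  (forall Z : {set V}, Z != finset.set0 -> minimal_separator e A Y L N Z ->
     is_cut e A Y L N (dmap e A Y L N Z) /\
     cut_capacity e A Y L N c (dmap e A Y L N Z) = (cost c Z)%:E) /\
  (forall S : {set V * bool}, is_cut e A Y L N S ->
     (cut_capacity e A Y L N c S < +oo)%E ->
     separator e A Y L N (hmap e A Y L N S) /\
     (cost c (hmap e A Y L N S))%:E = cut_capacity e A Y L N c S) /\
  (forall Z : {set V}, Z != finset.set0 -> min_cost_separator e A Y L N c Z ->
     min_cut e A Y L N c (dmap e A Y L N Z)) /\
  (forall S : {set V * bool}, min_cut e A Y L N c S ->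
     min_cost_separator e A Y L N c (hmap e A Y L N S)) /\
  (forall Z : {set V}, min_cost_separator e A Y L N c Z ->
     hmap e A Y L N (dmap e A Y L N Z) = Z).
Proof.
have [Z adjZ] := adj.
have AY : connect e A Y.
  by have := Y_de_A; rewrite -[_ \in _]negbK -finset.in_setC nd1E negbK.
have nAY := adjustment_set_not_adjacent e_acyclic AY A_neq_Y L_nd_A TA_gt1 adjZ.
split=> [W W0 minW|].
  by split; [apply: dmap_cut|apply: dmap_cut_capacity].
split=> [S cutS finS|]; first exact: finite_cut_separator.
split=> [W W0 minW|]; first exact: min_cost_min_cut.
split=> [S minS|W minW]; first exact: min_cut_min_cost.
by apply: hmap_dmap => //; apply: min_cost_minimal minW.
Qed.
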